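(* Let $R$ be an Osserman algebraic curvature tensor in $\mathbb{R}^n$. Let $m$ be the maximal multiplicity of the eigenvalues of its Jacobi operator and let $\nu = n - 1 - m$. If $$n \ge 3\nu \quad \text{and} \quad n > \frac{(\nu+1)^2}{4},$$ then $R$ has a $\mathrm{Cliff}(\nu)$-structure.
   Context: An algebraic curvature tensor $R$ in the Euclidean space $\mathbb{R}^n$ is a $(3,1)$ tensor having the same symmetries as the curvature tensor of a Riemannian manifold: $R(X,Y)Z=-R(Y,X)Z$, $\langle R(X,Y)Z,W\rangle=-\langle R(X,Y)W,Z\rangle$, $\langle R(X,Y)Z,W\rangle=\langle R(Z,W)X,Y\rangle$, and the first Bianchi identity $R(X,Y)Z+R(Y,Z)X+R(Z,X)Y=0$. For $X \in \mathbb{R}^n$ the Jacobi operator is the symmetric operator $R_X Y = R(X,Y)X$; $R_XX=0$. ''Eigenvalues of the Jacobi operator'' (and their multiplicities) are those of the restriction of $R_X$, with $X$ a unit vector, to $X^\perp$. $R$ is called Osserman if these eigenvalues (with multiplicities) do not depend on the choice of the unit vector $X$. $R$ has a $\mathrm{Cliff}(\nu)$-structure if there exist real numbers $\lambda_0, \mu_1,\dots,\mu_\nu$ with $\mu_s\neq\lambda_0$ for all $s$ (the $\mu_s$ need not be distinct) and skew-symmetric orthogonal operators $J_1,\dots,J_\nu$ on $\mathbb{R}^n$ satisfying the Hurwitz relations $J_sJ_q+J_qJ_s=-2\delta_{qs}I_n$ such that for all $X,Y,Z\in\mathbb{R}^n$ $$R(X,Y)Z=\lambda_0(\langle X,Z\rangle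 Y-\langle Y,Z\rangle X)+\sum_{s=1}^{\nu}\tfrac13(\mu_s-\lambda_0)\bigl(2\langle J_sX,Y\rangle J_sZ+\langle J_sZ,Y\rangle J_sX-\langle J_sZ,X\rangle J_sY\bigr).$$ *)

(* Defs.v *)
From HB Require Import structures.
From mathcomp Require Import all_boot all_order all_algebra.
From mathcomp Require Import reals.

Set Implicit Arguments.
Unset Strict Implicit.
Unset Printing Implicit Defensive.

Import Order.TTheory GRing.Theory Num.Theory.
Local Open Scope ring_scope.

(* Vectors of the Euclidean space R^n are row vectors, and a matrix A acts as
   the operator [u |-> u *m A]. *)

Definition dotv (R : realType) (n : nat) (u v : 'rV[R]_n) : R :=
  (u *m v^T) 0 0.

Definition unit_vector (R : realType) (n : nat) (X : 'rV[R]_n) : Prop :=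
  dotv X X = 1.

Definition tensor31 (R : realType) (n : nat) : Type :=
  'rV[R]_n -> 'rV[R]_n -> 'rV[R]_n -> 'rV[R]_n.

Record algebraic_curvature_tensor (R : realType) (n : nat)
    (T : tensor31 R n) : Prop := AlgebraicCurvatureTensor {
  act_linear1 : forall Y Z, linear (fun X => T X Y Z);
  act_linear2 : forall X Z, linear (fun Y => T X Y Z);
  act_linear3 : forall X Y, linear (fun Z => T X Y Z);
  act_skew12 : forall X Y Z, T X Y Z = - T Y X Z;
  act_skew34 : forall X Y Z W, dotv (T X Y Z) W = - dotv (T X Y W) Z;
  act_pair_sym : forall X Y Z W, dotv (T X Y Z) W = dotv (T Z W X) Y;
  act_bianchi : forall X Y Z, T X Y Z + T Y Z X + T Z X Y = 0
}.

(* When T is linear in its second argument, [Y *m jacobi T X = T X Y X]. *)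
Definition jacobi (R : realType) (n : nat) (T : tensor31 R n)
    (X : 'rV[R]_n) : 'M[R]_n :=
  lin1_mx (fun Y => T X Y X).

(* The multiplicity of [a] for the restriction of the Jacobi operator to the
   orthogonal complement of X, which is the row space of [kermx X^T]; it is 0
   when [a] is not an eigenvalue of this restriction. The Jacobi operator is
   symmetric, so geometric and algebraic multiplicities coincide. *)
Definition jacobi_mult (R : realType) (n : nat) (T : tensor31 R n)
    (X : 'rV[R]_n) (a : R) : nat :=
  \rank (eigenspace (jacobi T X) a :&: kermx X^T)%MS.

Definition osserman (R : realType) (n : nat) (T : tensor31 R n) : Prop :=
  forall X X' : 'rV[R]_n, unit_vector X -> unit_vector X' ->
  forall a : R, jacobi_mult T X a = jacobi_mult T X' a.

(* For n = 1 the restricted Jacobi operator has no eigenvalue, and the maximal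
   multiplicity is then 0. *)
Definition max_jacobi_mult (R : realType) (n : nat) (T : tensor31 R n)
    (m : nat) : Prop :=
  (exists X a, unit_vector X /\ jacobi_mult T X a = m) /\
  (forall X a, unit_vector X -> (jacobi_mult T X a <= m)%N).

Definition cliff_structure (R : realType) (n : nat) (nu : nat)
    (T : tensor31 R n) : Prop :=
  exists (lambda0 : R) (mu : 'I_nu -> R) (J : 'I_nu -> 'M[R]_n),
    [/\ forall s, mu s <> lambda0,
        forall s, (J s)^T = - J s,
        forall s, J s *m (J s)^T = 1%:M,
        forall s q, J s *m J q + J q *m J s = (- (2 * (s == q)%:R))%:M &
        forall X Y Z : 'rV[R]_n,
          T X Y Z =
            lambda0 *: (dotv X Z *: Y - dotv Y Z *: X)
            + \sum_(s < nu) (3^-1 * (mu s - lambda0)) *: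
                ((2 * dotv (X *m J s) Y) *: (Z *m J s)
                 + dotv (Z *m J s) Y *: (X *m J s)
                 - dotv (Z *m J s) X *: (Y *m J s))].

(* Main.v *)
(* Let l be the eigenvalue of multiplicity m, and let P(X) be the symmetric
   matrix R_X - l (|X|^2 - X X^T), quadratic in X and of rank nu for every X <> 0.

   Expanding P(X + tY) to second order at t = 0, constancy of the rank gives on
   each kernel K(X) = ker P(X), a space of dimension n - nu, a factorization
   P(Z) = B(Z) D B(Z)^T with B linear in Z. Since n >= 3 nu, there are Z1, Z2
   such that the ranges of P(Z1) and P(Z2) are independent. The normalized
   factorizations on three-dimensional spaces containing Z1 and Z2 are then
   unique and given by linear equations, so they glue to a linear B on R^n.

   The matrices B(Y)^T B(Y) have constant spectrum relative to D^-1 on the unit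
   sphere. The kernel of the pencil at the extreme eigenvalue, of dimension k,
   does not depend on Y because (k + 1)(nu - k) <= (nu + 1)^2 / 4 < n. Deflating
   these eigenvectors one at a time yields B(Y)^T B(Y) = |Y|^2 in a basis that
   diagonalizes D, and the columns of B are then Y |-> J_s Y. *)

From HB Require Import structures.
Require Import Defs.
From mathcomp Require Import all_boot all_order all_algebra.
From mathcomp Require Import reals.
From mathcomp Require Import ring lra zify.
From mathcomp Require Import boolp classical_sets topology normedtype derive.

Set Implicit Arguments.
Unset Strict Implicit.
Unset Printing Implicit Defensive.

Import Order.TTheory GRing.Theory Num.Theory.
Import numFieldNormedType.Exports.
Local Open Scope ring_scope.

(** * Matrix families of constant rank *)

Lemma poly_eval0_eq0 (R : numDomainType) (p : {poly R}) :
  (forall x, p.[x] = 0) -> p = 0.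
Proof.
move=> p0; apply: (@roots_geq_poly_eq0 _ _ [seq i%:R | i <- iota 0 (size p)]).
- by apply/allP => x _; apply/rootP.
- by rewrite map_inj_uniq ?iota_uniq // => i j /eqP; rewrite eqr_nat => /eqP.
- by rewrite size_map size_iota.
Qed.

(** The ranks of [A *m N *m C], [A *m N] and [N] are squeezed to the same value [r], so
    [u *m N = x *m (A *m N)] for some [x], and multiplying by [C] recovers [x]. This is the
    vanishing of a Schur complement. *)
Lemma mulmx_schur (F : fieldType) k l p q r (N : 'M[F]_(p, q))
    (A : 'M_(r, p)) (C : 'M_(q, r)) (u : 'M_(k, p)) (w : 'M_(q, l)) :
  (\rank N <= r)%N -> A *m N *m C \in unitmx ->
  u *m N *m w = u *m N *m C *m invmx (A *m N *m C) *m (A *m N *m w).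
Proof.
move=> rN uANC.
have /submxP[x ux] : (u *m N <= A *m N)%MS.
  apply: (submx_trans (submxMl _ _)).
  rewrite -(mxrank_leqif_sup (submxMl A N)) eqn_leq mxrankM_maxr /=.
  by rewrite (leq_trans rN) // -{1}(mxrank_unit uANC) mxrankM_maxl.
by rewrite ux -[x *m _ *m C]mulmxA mulmxK // -!mulmxA.
Qed.

(** The adjugate replaces the inverse so that the identity stays polynomial. It holds at each [t]
    where the determinant is nonzero. Hence the determinant times each entry of the difference
    vanishes everywhere, and is the zero polynomial. *)
Lemma polymx_schur (R : numFieldType) k l p q r (N : 'M[{poly R}]_(p, q))
    (A : 'M_(r, p)) (C : 'M_(q, r)) (u : 'M_(k, p)) (w : 'M_(q, l)) :
  (forall t, (\rank (map_mx (horner_eval t) N) <= r)%N) ->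
  \det (A *m N *m C) != 0 ->
  \det (A *m N *m C) *: (u *m N *m w)
    = u *m N *m C *m \adj (A *m N *m C) *m (A *m N *m w).
Proof.
move=> rN d0; apply/eqP; rewrite -subr_eq0; apply/eqP.
set D := _ - _; apply/matrixP => i j; rewrite [RHS]mxE.
apply/eqP; have := mulf_eq0 (\det (A *m N *m C)) (D i j).
rewrite (negPf d0) /= => <-; apply/eqP/poly_eval0_eq0 => t.
rewrite hornerM; case: (eqVneq (\det (A *m N *m C)).[t] 0) => [->|dt].
  by rewrite mul0r.
suff -> : (D i j).[t] = 0 by rewrite mulr0.
suff : map_mx (horner_eval t) D = 0 by move/matrixP/(_ i j); rewrite !mxE.
have hdet : \det (map_mx (horner_eval t) (A *m N *m C))
    = (\det (A *m N *m C)).[t] by rewrite det_map_mx.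
have uu : map_mx (horner_eval t) (A *m N *m C) \in unitmx.
  by rewrite unitmxE hdet unitfE.
rewrite map_mxB map_mxZ /horner_eval !map_mxM /= map_mx_adj.
rewrite -[X in X *: _]hdet; move: uu (hdet); rewrite !map_mxM /= => uu hd.
apply/eqP; rewrite subr_eq0.
rewrite (mulmx_schur (map_mx _ u) (map_mx _ w) (rN t) uu) /invmx uu.
by rewrite -scalemxAr -scalemxAl scalerA divff ?hd // scale1r.
Qed.

Lemma scalemx_inj (R : idomainType) m n (a : R) (A B : 'M[R]_(m, n)) :
  a *: A = a *: B -> a != 0 -> A = B.
Proof.
move=> e a0; apply/matrixP => i j; apply: (mulfI a0).
by move/matrixP: e => /(_ i j); rewrite mxE [in RHS]mxE.
Qed.

(* In the Schur complement identity both border blocks carry a factor 'X^d, so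
   their product carries 'X^(2d), while the corner carries only one 'X^d. *)
Lemma polymx_divided_eval0 (R : numFieldType) k l p q (N : 'M[{poly R}]_(p, q))
    (d : nat) (U : 'M_(k, p)) (W : 'M_(q, l)) U1 W1 :
  (forall t, (\rank (map_mx (horner_eval t) N)
              <= \rank (map_mx (horner_eval 0) N))%N) ->
  (0 < d)%N -> U *m N = 'X^d *: U1 -> N *m W = 'X^d *: W1 ->
  map_mx (horner_eval 0) U1 *m map_mx (horner_eval 0) W = 0.
Proof.
move=> rN d0 UN NW; set M0 := map_mx (horner_eval 0) N.
(* These one-sided inverses of the rank factors of [M0] make [A *m N *m C] the identity at 0, so its
   determinant is a nonzero polynomial. *)
pose A := map_mx polyC (pinvmx (col_base M0)).
pose C := map_mx polyC (pinvmx (row_base M0)).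
have evC a b (B : 'M[R]_(a, b)) : map_mx (horner_eval 0) (map_mx polyC B) = B.
  by apply/matrixP => i j; rewrite !mxE /horner_eval hornerC.
have ev1 : map_mx (horner_eval 0) (A *m N *m C) = 1%:M.
  rewrite !map_mxM !evC -/M0 -[X in _ *m X *m _]mulmx_base.
  move: (mulVpmx (col_base_full M0)) (mulmxVp (row_base_free M0)).
  move: (col_base _) (row_base _) (pinvmx _) (pinvmx _) => L E L' E' L'L EE'.
  by rewrite mulmxA L'L mul1mx.
have d1 : (\det (A *m N *m C)).[0] = 1.
  by have := det_map_mx (horner_eval 0) (A *m N *m C); rewrite ev1 det1.
have dn0 : \det (A *m N *m C) != 0.
  by apply/eqP => e0; move: d1; rewrite e0 horner0 => /esym/eqP; rewrite oner_eq0.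
have := polymx_schur U W rN dn0.
rewrite UN -[A *m N *m W]mulmxA NW -!scalemxAl -!scalemxAr scalerA mulrC -scalerA.
move=> /scalemx_inj e.
have := congr1 (map_mx (horner_eval 0)) (e (monic_neq0 (monicXn _ _))).
rewrite -map_mxM !map_mxZ /= !horner_evalE. 
rewrite d1 scale1r => ->.
by rewrite hornerXn expr0n eqn0Ngt d0 scale0r.
Qed.

Section RankPerturbation.
Variables (R : numFieldType) (p q : nat) (M0 M1 M2 : 'M[R]_(p, q)).
Hypothesis rM : forall t, (\rank (M0 + t *: M1 + t ^+ 2 *: M2)%R <= \rank M0)%N.

Let N := map_mx polyC M0 + 'X *: map_mx polyC M1 + 'X^2 *: map_mx polyC M2.

Let evC t a b (B : 'M[R]_(a, b)) : map_mx (horner_eval t) (map_mx polyC B) = B.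
Proof. by apply/matrixP => i j; rewrite !mxE /horner_eval hornerC. Qed.

Let evN t : map_mx (horner_eval t) N = M0 + t *: M1 + t ^+ 2 *: M2.
Proof.
by rewrite /N !map_mxD !map_mxZ !evC /= !horner_evalE hornerX hornerXn.
Qed.

Let rN t : (\rank (map_mx (horner_eval t) N)
            <= \rank (map_mx (horner_eval 0) N))%N.
Proof. by rewrite !evN expr0n !scale0r !addr0. Qed.

(** [u *m N] and [N *m w] are both divisible by ['X]. Geometrically, [M1] is tangent to the variety
    of matrices of rank at most [\rank M0]. *)
Lemma rank_perturb1 k l (u : 'M_(k, p)) (w : 'M_(q, l)) :
  u *m M0 = 0 -> M0 *m w = 0 -> u *m M1 *m w = 0.
Proof.
move=> u0 w0.
have := polymx_divided_eval0 (d := 1) (U := map_mx polyC u)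
  (W := map_mx polyC w)
  (U1 := map_mx polyC (u *m M1) + 'X *: map_mx polyC (u *m M2))
  (W1 := map_mx polyC (M1 *m w) + 'X *: map_mx polyC (M2 *m w)) rN.
rewrite map_mxD map_mxZ !evC /= !horner_evalE hornerX scale0r addr0; apply=> //.
  rewrite /N !mulmxDr -!scalemxAr -!map_mxM /= u0 map_mx0 add0r.
  by rewrite scalerDr scalerA -expr2 expr1.
rewrite /N !mulmxDl -!scalemxAl -!map_mxM /= w0 map_mx0 add0r.
by rewrite scalerDr scalerA -expr2 expr1.
Qed.

(** The corrected vectors [u - 'X y] and [w - 'X z] annihilate [N] up to order 2, which gives
    [(u *m M2 - y *m M1) *m w = 0]. *)
Lemma rank_perturb2 k l (u y : 'M_(k, p)) (w z : 'M_(q, l)) :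
  u *m M0 = 0 -> M0 *m w = 0 -> u *m M1 = y *m M0 -> M1 *m w = M0 *m z ->
  u *m M2 *m w = y *m M0 *m z.
Proof.
move=> u0 w0 uy wz.
have := polymx_divided_eval0 (d := 2)
  (U := map_mx polyC u - 'X *: map_mx polyC y)
  (W := map_mx polyC w - 'X *: map_mx polyC z)
  (U1 := map_mx polyC (u *m M2 - y *m M1) - 'X *: map_mx polyC (y *m M2))
  (W1 := map_mx polyC (M2 *m w - M1 *m z) - 'X *: map_mx polyC (M2 *m z)) rN.
rewrite !map_mxB !map_mxZ !evC /= !horner_evalE hornerX !scale0r !subr0.
move=> e; apply/eqP; rewrite -subr_eq0 -(mulmxA y) -wz mulmxA -mulmxBl; apply/eqP.
apply: e => //.
- rewrite /N mulmxBl !mulmxDr -!scalemxAl -!scalemxAr -!map_mxM /= u0 uy map_mx0.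
  by apply/matrixP => i j; rewrite !mxE; ring.
- rewrite /N mulmxBr !mulmxDl -!scalemxAr -!scalemxAl -!map_mxM /= w0 wz map_mx0.
  by apply/matrixP => i j; rewrite !mxE; ring.
Qed.
End RankPerturbation.

(** * Flatness on kernels *)

Lemma mulmx_rV_ext (R : pzSemiRingType) m n (A B : 'M[R]_(m, n)) :
  (forall u : 'rV_m, u *m A = u *m B) -> A = B.
Proof. by move=> AB; apply/row_matrixP => i; rewrite !rowE. Qed.

Lemma mul_rV_linear1 (R : comPzRingType) m n (f : 'rV[R]_m -> 'rV[R]_n) :
  linear f -> forall u, u *m lin1_mx f = f u.
Proof.
move=> linf u.
pose g : {linear 'rV[R]_m -> 'rV[R]_n} :=
  HB.pack f (GRing.isLinear.Build _ _ _ _ f linf).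
exact: (mul_rV_lin1 g).
Qed.

Lemma symmx_form_eq (R : numFieldType) n (A B : 'M[R]_n) :
  A^T = A -> B^T = B -> (forall u : 'rV_n, u *m A *m u^T = u *m B *m u^T) ->
  A = B.
Proof.
move=> sA sB AB; apply/eqP; rewrite -subr_eq0; apply/eqP.
have sC : (A - B)^T = A - B by rewrite linearB /= sA sB.
have C0 (u : 'rV_n) : u *m (A - B) *m u^T = 0.
  by rewrite mulmxBr mulmxBl AB subrr.
move: (A - B) sC C0 => C sC C0.
have C1 (u v : 'rV_n) : u *m C *m v^T = 0.
  have := C0 (u + v); rewrite linearD /= !mulmxDl !mulmxDr !C0 addr0 add0r.
  have -> : v *m C *m u^T = (u *m C *m v^T)^T.
    by rewrite !trmx_mul trmxK sC mulmxA.
  move/matrixP => e; apply/matrixP => i j; rewrite !ord1.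
  by move: (e 0 0); rewrite !mxE => /eqP; rewrite -mulr2n mulrn_eq0 => /eqP.
apply: mulmx_rV_ext => u; rewrite mulmx0; apply: trmx_inj; apply: mulmx_rV_ext => v.
have := congr1 trmx (C1 u v).
by rewrite trmx_mul trmxK !trmx0 mulmx0.
Qed.

(** [V *m F] is a projector onto the column space of [M]. By symmetry it can be applied on both
    sides, whence the core [D = F *m M *m F^T]. *)
Lemma symmx_rank_decomp (R : fieldType) n r (M : 'M[R]_n) :
  M^T = M -> \rank M = r ->
  exists (V : 'M_(n, r)) (F : 'M_(r, n)) (D : 'M_r),
    [/\ F *m V = 1%:M, D^T = D, D \in unitmx & M = V *m D *m V^T].
Proof.
move=> sM rM.
have [V [F [W [FV MVW]]]] : exists (V : 'M_(n, r)) (F W : 'M_(r, n)),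
    F *m V = 1%:M /\ M = V *m W.
  rewrite -rM; exists (row_base M)^T, (pinvmx (row_base M))^T, (col_base M)^T.
  by rewrite -!trmx_mul mulmxVp ?row_base_free // trmx1 mulmx_base.
have VFM : V *m F *m M = M.
  by rewrite MVW -mulmxA (mulmxA F) FV mul1mx.
have eM : M = V *m (F *m M *m F^T) *m V^T.
  have -> : V *m (F *m M *m F^T) *m V^T = (V *m F *m M) *m (V *m F)^T.
    by rewrite trmx_mul !mulmxA.
  by rewrite VFM -{2}sM -trmx_mul VFM sM.
exists V, F, (F *m M *m F^T); split => //.
  by rewrite !trmx_mul trmxK sM mulmxA.
rewrite -row_free_unit /row_free eqn_leq rank_leq_row -{1}rM {1}eM.
by rewrite (leq_trans (mxrankM_maxl _ _)) // mxrankM_maxr.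
Qed.

Definition quad (R : numFieldType) n p (Pb : 'rV[R]_n -> 'rV[R]_n -> 'M[R]_p)
    X :=
  2^-1 *: Pb X X.

(* Pb is the polarization of P := quad Pb: Pb X X = 2 P X and
   P (X + t Y) = P X + t Pb X Y + t^2 P Y. *)
Record jacobi_family (R : numFieldType) n r
    (Pb : 'rV[R]_n -> 'rV[R]_n -> 'M[R]_n) : Prop := JacobiFamily {
  jf_linear : forall a X X' Y, Pb (a *: X + X') Y = a *: Pb X Y + Pb X' Y;
  jf_sym : forall X Y, Pb X Y = Pb Y X;
  jf_tr : forall X Y, (Pb X Y)^T = Pb X Y;
  jf_swap : forall X Y, X *m quad Pb Y *m X^T = Y *m quad Pb X *m Y^T;
  jf_rank : forall X, X != 0 -> \rank (quad Pb X) = r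
}.

Lemma quad_line (R : numFieldType) n p (Pb : 'rV[R]_n -> 'rV[R]_n -> 'M[R]_p) :
  (forall a X X' Y, Pb (a *: X + X') Y = a *: Pb X Y + Pb X' Y) ->
  (forall X Y, Pb X Y = Pb Y X) ->
  forall X Y t, quad Pb (X + t *: Y) = quad Pb X + t *: Pb X Y + t ^+ 2 *: quad Pb Y.
Proof.
move=> lP sP X Y t; rewrite /quad (addrC X) lP [Pb Y _]sP [Pb X _]sP !lP (sP Y X).
by apply/matrixP => i j; rewrite !mxE; field.
Qed.

Lemma polar0 (R : numFieldType) n p (Pb : 'rV[R]_n -> 'rV[R]_n -> 'M[R]_p) :
  (forall a X X' Y, Pb (a *: X + X') Y = a *: Pb X Y + Pb X' Y) ->
  forall Y, Pb 0 Y = 0.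
Proof.
by move=> lP Y; have := lP (-1) 0 0 Y; rewrite scaler0 addr0 scaleN1r addNr.
Qed.

Lemma quadZ (R : numFieldType) n p (Pb : 'rV[R]_n -> 'rV[R]_n -> 'M[R]_p) :
  (forall a X X' Y, Pb (a *: X + X') Y = a *: Pb X Y + Pb X' Y) ->
  (forall X Y, Pb X Y = Pb Y X) ->
  forall a X, quad Pb (a *: X) = a ^+ 2 *: quad Pb X.
Proof.
move=> lP sP a X; have := quad_line lP sP 0 X a.
by rewrite add0r polar0 // scaler0 addr0 {2}/quad polar0 // scaler0 add0r.
Qed.

Lemma quad0 (R : numFieldType) n p (Pb : 'rV[R]_n -> 'rV[R]_n -> 'M[R]_p) :
  (forall a X X' Y, Pb (a *: X + X') Y = a *: Pb X Y + Pb X' Y) ->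
  quad Pb 0 = 0.
Proof. by move=> lP; rewrite /quad polar0 // scaler0. Qed.

Section JacobiFamily.
Variables (R : numFieldType) (n r : nat) (Pb : 'rV[R]_n -> 'rV[R]_n -> 'M[R]_n).
Hypothesis PbJ : jacobi_family r Pb.
Local Notation P := (quad Pb).

Lemma jf_quad_tr X : (P X)^T = P X.
Proof. by rewrite /quad linearZ /= (jf_tr PbJ). Qed.

Lemma jf_linear2 X : linear (Pb X).
Proof. by move=> a Y Y'; rewrite !(jf_sym PbJ X) (jf_linear PbJ). Qed.

(* The second order condition for P (X + t Y) to keep the rank of P X expresses
   the restriction of the form P Y to ker (P X) through the first order term
   Z *m Pb X Y, linear in Z. The symmetry Z P(Y) Z^T = Y P(Z) Y^T turns this
   into a factorization of the whole matrix P Z. *)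
Lemma flat_on_kernel X : X != 0 ->
  exists (D : 'M[R]_r) (B : 'rV[R]_n -> 'M[R]_(n, r)),
    [/\ D^T = D, D \in unitmx, linear B &
        forall Z, Z *m P X = 0 -> P Z = B Z *m D *m (B Z)^T /\ X *m B Z = 0].
Proof.
move=> X0.
have [V [F [D [FV sD uD PX]]]] := symmx_rank_decomp (jf_quad_tr X) (jf_rank PbJ X0).
pose B Z := lin1_mx (fun Y => Z *m Pb X Y *m F^T).
have linb Z : linear (fun Y => Z *m Pb X Y *m F^T).
  by move=> a Y Y'; rewrite jf_linear2 mulmxDr mulmxDl -scalemxAr -scalemxAl.
have YB Z Y : Y *m B Z = Z *m Pb X Y *m F^T by exact: mul_rV_linear1.
exists (invmx D), B; split.
- by rewrite trmx_inv sD.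
- by rewrite unitmx_inv.
- move=> a Z Z'; apply: mulmx_rV_ext => Y.
  by rewrite mulmxDr -scalemxAr !YB !mulmxDl -!scalemxAl.
move=> Z ZX; split; last first.
  rewrite YB; have -> : Pb X X = 2 *: P X by rewrite scalerA mulfV ?pnatr_eq0 ?scale1r.
  by rewrite -scalemxAr ZX scaler0 mul0mx.
have rk Y t : (\rank (P X + t *: Pb X Y + t ^+ 2 *: P Y)%R <= \rank (P X))%N.
  rewrite -quad_line; [|exact: jf_linear PbJ|exact: jf_sym PbJ].
  rewrite (jf_rank PbJ X0); case: (eqVneq (X + t *: Y) 0) => [->|/(jf_rank PbJ) -> //].
  by rewrite quad0 ?mxrank0 //; exact: jf_linear PbJ.
(* The columns of [1%:M - F^T *m V^T] lie in the kernel of [P X], so the first order condition puts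
   [Z *m Pb X Y] in the row space of [V^T]. *)
have proj Y : Z *m Pb X Y = Z *m Pb X Y *m F^T *m V^T.
  have : Z *m Pb X Y *m (1%:M - F^T *m V^T) = 0.
    apply: (rank_perturb1 (rk Y)) => //.
    rewrite PX -mulmxA mulmxBr mulmx1 -!mulmxA (mulmxA V^T) -trmx_mul FV.
    by rewrite trmx1 mul1mx subrr.
  by rewrite mulmxBr mulmx1 mulmxA => /subr0_eq.
apply: symmx_form_eq; first exact: jf_quad_tr.
  by rewrite !trmx_mul trmxK trmx_inv sD mulmxA.
move=> Y; rewrite (jf_swap PbJ) -/P.
pose y := Z *m Pb X Y *m F^T *m invmx D *m F.
have yP : Z *m Pb X Y = y *m P X.
  by rewrite PX /y -!mulmxA (mulmxA F) FV mul1mx mulKmx // [RHS]mulmxA [RHS]mulmxA -proj.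
have zP : Pb X Y *m Z^T = P X *m y^T.
  by rewrite -(jf_tr PbJ) -trmx_mul yP trmx_mul jf_quad_tr.
have PZ : P X *m Z^T = 0 by rewrite -jf_quad_tr -trmx_mul ZX trmx0.
rewrite (rank_perturb2 (rk Y) ZX PZ yP zP) -yP.
have -> : Y *m (B Z *m invmx D *m (B Z)^T) *m Y^T
    = (Y *m B Z) *m invmx D *m (Y *m B Z)^T by rewrite trmx_mul !mulmxA.
rewrite YB /y; move: (Z *m _) => b.
by rewrite (trmx_mul (b *m _ *m _)) (trmx_mul (b *m _)) trmx_inv sD !mulmxA.
Qed.
End JacobiFamily.

(** * Gluing the local factorizations *)

Lemma mxrank_row_mx (F : fieldType) m n1 n2 (A : 'M[F]_(m, n1)) (B : 'M_(m, n2)) :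
  (\rank (row_mx A B) <= \rank A + \rank B)%N.
Proof.
rewrite -mxrank_tr tr_row_mx -addsmxE -(mxrank_tr A) -(mxrank_tr B).
exact: (mxrank_adds_leqif A^T B^T).1.
Qed.

Lemma left_kernel_neq0 (F : fieldType) m n (A : 'M[F]_(m, n)) :
  (\rank A < m)%N -> exists2 u : 'rV_m, u != 0 & u *m A = 0.
Proof.
move=> rA; have : kermx A != 0 by rewrite -mxrank_eq0 mxrank_ker -lt0n subn_gt0.
by move=> /rowV0Pn[u /sub_kermxP uA u0]; exists u.
Qed.

Lemma row_full_row_mx (F : fieldType) m n1 n2 (A : 'M[F]_(m, n1)) (B : 'M_(m, n2)) :
  row_full (row_mx A B) ->
  exists (A' : 'M_(n1, m)) (B' : 'M_(n2, m)),
    [/\ A' *m A = 1%:M, A' *m B = 0, B' *m A = 0 & B' *m B = 1%:M].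
Proof.
move=> /row_fullP[C]; rewrite -[C]vsubmxK mul_col_row scalar_mx_block.
by move=> /eq_block_mx[*]; exists (usubmx C), (dsubmx C).
Qed.

(** Multiplying the equality by [L^T *m invmx D] on the right solves for [A]. When [D' = D], the
    matrix [g] preserves the form [D]: this is the only freedom in a factorization. *)
Lemma mulmx_form_factor (F : fieldType) n r (A A' : 'M[F]_(n, r)) (D D' : 'M_r)
    (L L' : 'M_(r, n)) :
  L *m A = 1%:M -> L' *m A' = 1%:M -> D \in unitmx ->
  A *m D *m A^T = A' *m D' *m A'^T ->
  exists2 g, A = A' *m g & g *m D *m g^T = D'.
Proof.
move=> LA LA' uD e; pose g := D' *m A'^T *m L^T *m invmx D.
have eA : A = A' *m g.
  rewrite /g !mulmxA -e -(mulmxA _ A^T) -trmx_mul LA trmx1 mulmx1.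
  by rewrite -mulmxA mulmxV // mulmx1.
exists g => //; have := congr1 (fun M => L' *m M *m L'^T) e.
rewrite {1 2}eA trmx_mul !mulmxA LA' !mul1mx -!mulmxA -trmx_mul LA' trmx1.
by rewrite !mulmx1.
Qed.

Section Gluing.
Variables (R : numFieldType) (n r : nat) (Pb : 'rV[R]_n -> 'rV[R]_n -> 'M[R]_n).
Hypothesis PbJ : jacobi_family r Pb.
Local Notation P := (quad Pb).

Lemma jf_rank_le X : (\rank (P X) <= r)%N.
Proof.
case: (eqVneq X 0) => [->|/(jf_rank PbJ) <- //].
by rewrite quad0 ?mxrank0 //; exact: jf_linear PbJ.
Qed.

Lemma jf_quadD X Y : P (X + Y) = P X + Pb X Y + P Y.
Proof.
have := quad_line (jf_linear PbJ) (jf_sym PbJ) X Y 1.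
by rewrite scale1r expr1n !scale1r.
Qed.

Lemma jf_left_inv X (B : 'M_(n, r)) D :
  X != 0 -> P X = B *m D *m B^T -> exists L, L *m B = 1%:M.
Proof.
move=> X0 PX; apply/row_fullP; rewrite /row_full eqn_leq rank_leq_col.
by rewrite -{1}(jf_rank PbJ X0) PX -mulmxA mxrankM_maxl.
Qed.

(** The duality principle: the factor [B Z] of [P Z] supplied by [flat_on_kernel] is annihilated by
    [X]. *)
Lemma jf_kernel_sym X Z : Z *m P X = 0 -> X *m P Z = 0.
Proof.
case: (eqVneq X 0) => [->|X0 ZX]; first by rewrite mul0mx.
have [D [B [_ _ _ /(_ Z ZX) [-> XB]]]] := flat_on_kernel PbJ X0.
by rewrite !mulmxA XB !mul0mx.
Qed.

Lemma jf_common2 (Z1 Z2 : 'rV_n) : (r + r < n)%N ->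
  exists2 X, X != 0 & Z1 *m P X = 0 /\ Z2 *m P X = 0.
Proof.
move=> rn; have [X X0] : exists2 X : 'rV_n, X != 0 & X *m row_mx (P Z1) (P Z2) = 0.
  apply: left_kernel_neq0; apply: leq_ltn_trans rn.
  by rewrite (leq_trans (mxrank_row_mx _ _)) // leq_add ?jf_rank_le.
rewrite mul_mx_row -[0]hsubmxK => /eq_row_mx[]; rewrite !linear0.
by move=> /jf_kernel_sym ? /jf_kernel_sym ?; exists X.
Qed.

(** The two factorizations of [P Z1] differ by some [g]. Multiplying the whole family on the right
    by [g] moves both the core and the value at [Z1] to the prescribed ones. *)
Lemma flat_on_kernel_from X Z1 (D : 'M_r) (B1 : 'M_(n, r)) :
  X != 0 -> Z1 != 0 -> Z1 *m P X = 0 -> D \in unitmx ->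
  P Z1 = B1 *m D *m B1^T ->
  exists B : 'rV_n -> 'M_(n, r),
    [/\ linear B, B Z1 = B1 &
        forall Z, Z *m P X = 0 -> P Z = B Z *m D *m (B Z)^T].
Proof.
move=> X0 Z10 ZX uD e1.
have [D0 [B0 [_ _ linB h]]] := flat_on_kernel PbJ X0.
have [e0 _] := h Z1 ZX.
have [L1 L1B] := jf_left_inv Z10 e1; have [L0 L0B] := jf_left_inv Z10 e0.
have e : B1 *m D *m B1^T = B0 Z1 *m D0 *m (B0 Z1)^T by rewrite -e1 -e0.
have [g eB gD] := mulmx_form_factor L1B L0B uD e.
exists (fun Z => B0 Z *m g); split => //.
  by move=> a Y Y'; rewrite linB mulmxDl -scalemxAl.
by move=> Z /h[-> _]; rewrite trmx_mul -gD !mulmxA.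
Qed.

Lemma flat_polar X (D : 'M_r) (B : 'rV_n -> 'M_(n, r)) : linear B ->
  (forall Z, Z *m P X = 0 -> P Z = B Z *m D *m (B Z)^T) ->
  forall Z Z', Z *m P X = 0 -> Z' *m P X = 0 ->
  Pb Z Z' = B Z *m D *m (B Z')^T + B Z' *m D *m (B Z)^T.
Proof.
move=> linB h Z Z' ZX Z'X; have BD : B (Z + Z') = B Z + B Z'.
  by have := linB 1 Z Z'; rewrite !scale1r.
have := jf_quadD Z Z'; rewrite [LHS]h ?mulmxDl ?ZX ?Z'X ?addr0 //.
rewrite BD linearD /= !mulmxDl !mulmxDr -h // -h // => e.
by apply: (addrI (P Z)); apply: (addIr (P Z')); rewrite -e -!addrA.
Qed.

(** Both vectors are taken in one kernel [ker (P X)], where a linear [B] exists. With [Z1] fixed,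
    the rank of [row_mx (B Z1) (B Z)] is raised one unit at a time by changing [Z]. *)
Lemma transversal_pair : (0 < n)%N -> (3 * r <= n)%N ->
  exists Z1 Z2 (D : 'M_r) (B1 B2 : 'M_(n, r)),
    [/\ Z1 != 0, Z2 != 0, D^T = D & D \in unitmx] /\
    [/\ P Z1 = B1 *m D *m B1^T, P Z2 = B2 *m D *m B2^T,
        Pb Z1 Z2 = B1 *m D *m B2^T + B2 *m D *m B1^T
      & row_full (row_mx B1 B2)].
Proof.
move=> n0 rn; have rn' : (r < n)%N by lia.
have [X X0 _] : exists2 X : 'rV[R]_n, X != 0 & X *m (0 : 'M_n) = 0.
  by apply: left_kernel_neq0; rewrite mxrank0.
have [D [B [sD uD linB h]]] := flat_on_kernel PbJ X0.
have hP Z : Z *m P X = 0 -> P Z = B Z *m D *m (B Z)^T by move=> /h[].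
have kD Z Z' t : Z *m P X = 0 -> Z' *m P X = 0 -> (Z + t *: Z') *m P X = 0.
  by move=> ZX Z'X; rewrite mulmxDl -scalemxAl ZX Z'X scaler0 addr0.
have [Z1 Z10 Z1X] := left_kernel_neq0 (leq_ltn_trans (jf_rank_le X) rn').
have [L1 L1B] := jf_left_inv Z10 (hP _ Z1X).
pose M Z := row_mx (B Z1) (B Z).
have [Z2 Z2X rM] : exists2 Z2, Z2 *m P X = 0 & (r + r <= \rank (M Z2))%N.
  suff rec k : (k <= r + r)%N -> exists2 Z2, Z2 *m P X = 0 & (k <= \rank (M Z2))%N.
    exact: rec.
  elim: k => [_|k IHk kr]; first by exists Z1.
  have [Z ZX kZ] := IHk (ltnW kr); apply: contrapT => no.
  have rle Z' : Z' *m P X = 0 -> (\rank (M Z') <= k)%N.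
    by move=> Z'X; rewrite leqNgt; apply/negP => ?; apply: no; exists Z'.
  have rZ : \rank (M Z) = k by apply/eqP; rewrite eqn_leq rle.
  have [w' w'0 Mw'] : exists2 w' : 'rV_(r + r), w' != 0 & w' *m (M Z)^T = 0.
    by apply: left_kernel_neq0; rewrite mxrank_tr rZ.
  pose a := usubmx w'^T; pose f := dsubmx w'^T.
  have Mw : M Z *m col_mx a f = 0.
    by rewrite vsubmxK -[M Z]trmxK -trmx_mul Mw' trmx0.
  (* If [f] vanished, the left inverse [L1] of [B Z1] would kill [a] as well. *)
  have f0 : f != 0.
    apply/eqP => f0; have : a = 0.
      move: Mw; rewrite mul_row_col f0 mulmx0 addr0 => /(congr1 (mulmx L1)).
      by rewrite mulmxA L1B mul1mx mulmx0.
    move=> a0; case/eqP: w'0; apply: trmx_inj.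
    by rewrite -[LHS]vsubmxK -/a -/f a0 f0 col_mx0 trmx0.
  (* [B Z1, B Z] has maximal rank, so the first order variation B Z' *m f along
     a kernel vector stays in its column space, of dimension < 2r. But
     Z' |-> B Z' *m f is injective on ker (P X), of dimension n - r >= 2r. *)
  have first_order Z' : Z' *m P X = 0 -> kermx (M Z) *m (B Z' *m f) = 0.
    move=> Z'X; have := @rank_perturb1 _ _ _ (M Z) (row_mx 0 (B Z')) 0 _ _ _
      (kermx (M Z)) (col_mx a f) (mulmx_ker _) Mw.
    rewrite -mulmxA mul_row_col mul0mx add0r; apply => t.
    rewrite scaler0 addr0 scale_row_mx scaler0 add_row_mx addr0 rZ addrC -linB.
    by rewrite addrC rle ?kD.
  pose L := lin1_mx (fun Z => (B Z *m f)^T).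
  have LE Z' : Z' *m L = (B Z' *m f)^T.
    apply: mul_rV_linear1 => c Y Y'.
    by rewrite linB mulmxDl -scalemxAl linearD linearZ.
  pose K := kermx (P X).
  have rKL : \rank (K *m L) = (n - r)%N.
    rewrite -[LHS]addn0 -(jf_rank PbJ X0) -mxrank_ker -(mxrank_mul_ker K L).
    congr (_ + _)%N; apply/esym/eqP; rewrite mxrank_eq0; apply/rowV0P => Z'.
    rewrite sub_capmx => /andP[/sub_kermxP Z'X /sub_kermxP].
    rewrite LE => /(congr1 trmx); rewrite trmxK trmx0 => Bf.
    apply/eqP/negPn/negP => Z'0; case/eqP: f0.
    have [L' L'B] := jf_left_inv Z'0 (hP _ Z'X).
    by rewrite -[f]mul1mx -L'B -mulmxA Bf mulmx0.
  have := mulmx0_rank_max (A := K *m L) (B := (kermx (M Z))^T).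
  rewrite rKL mxrank_tr mxrank_ker rZ => rk.
  suff : K *m L *m (kermx (M Z))^T = 0 by move=> /rk; lia.
  apply/row_matrixP => i; rewrite row0 2!row_mul LE -trmx_mul first_order ?trmx0 //.
  by rewrite -row_mul mulmx_ker row0.
(* If [Z2 = 0] then [B Z2 = 0], and rank at least [r + r] forces [r = 0]; then [Z1] itself serves as
   the second vector. *)
wlog Z20 : Z2 Z2X rM / Z2 != 0 => [hwlog|].
  case: (eqVneq Z2 0) => [Z20|]; last exact: hwlog.
  apply: (hwlog Z1) => //; suff r0 : r = 0%N by apply: leq_trans (leq0n _); rewrite r0.
  have B0 : B Z2 = 0.
    by have := linB (-1) 0 0; rewrite scaler0 addr0 scaleN1r addNr Z20.
  have := leq_trans rM (mxrank_row_mx _ _); rewrite B0 mxrank0 addn0.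
  by have := rank_leq_col (B Z1); lia.
exists Z1, Z2, D, (B Z1), (B Z2); split; split=> //; try exact: hP.
  exact: (flat_polar linB hP).
by rewrite /row_full eqn_leq rank_leq_col.
Qed.

(** If the ranges of [P Z1], [P Z2] and [P Y] do not span, some nonzero [X] has all three vectors in
    [ker (P X)], and the linear factorization on that kernel, normalized at [Z1], provides [B]. *)
Lemma flat_extension (Z1 Z2 Y : 'rV_n) (D : 'M_r) (B1 B2 : 'M_(n, r)) :
  (0 < n)%N -> (3 * r <= n)%N -> Z1 != 0 -> Z2 != 0 -> D^T = D -> D \in unitmx ->
  P Z1 = B1 *m D *m B1^T -> P Z2 = B2 *m D *m B2^T ->
  Pb Z1 Z2 = B1 *m D *m B2^T + B2 *m D *m B1^T -> row_full (row_mx B1 B2) ->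
  exists B : 'M_(n, r),
    [/\ Pb Z1 Y = B1 *m D *m B^T + B *m D *m B1^T,
        Pb Z2 Y = B2 *m D *m B^T + B *m D *m B2^T & P Y = B *m D *m B^T].
Proof.
move=> n0 rn Z10 Z20 sD uD e1 e2 e12 fB; have rn2 : (r + r < n)%N by lia.
case: (eqVneq Y 0) => [->|Y0].
  have Pb0 Z : Pb Z 0 = 0 by rewrite (jf_sym PbJ) (polar0 (jf_linear PbJ)).
  by exists 0; rewrite !Pb0 (quad0 (jf_linear PbJ)) !trmx0 !mulmx0 !mul0mx !addr0.
case: (ltnP (\rank (row_mx (P Z1) (row_mx (P Z2) (P Y)))) n) => [rk|rk].
  have [X X0] := left_kernel_neq0 rk.
  rewrite !mul_mx_row -[0]hsubmxK -[rsubmx _]hsubmxK => /eq_row_mx[+ /eq_row_mx[]].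
  rewrite !linear0 => /jf_kernel_sym Z1X /jf_kernel_sym Z2X /jf_kernel_sym YX.
  have [B [linB eB1 hB]] := flat_on_kernel_from X0 Z10 Z1X uD e1.
  (* The values at [Z2] differ by some [g]. Sandwiching the two expressions of [Pb Z1 Z2] between
     [L2] and [L1^T] leaves [g *m D = D]. *)
  suff eB2 : B Z2 = B2.
    exists (B Y); rewrite -eB1 -eB2; split; last exact: hB.
      exact: (flat_polar linB hB).
    exact: (flat_polar linB hB).
  have [L1 [L2 [LB11 LB12 LB21 LB22]]] := row_full_row_mx fB.
  have [L L2B] := jf_left_inv Z20 (hB _ Z2X).
  have [g eg gD] : exists2 g, B Z2 = B2 *m g & g *m D *m g^T = D.
    by apply: (mulmx_form_factor L2B LB22 uD); rewrite -e2 hB.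
  have := flat_polar linB hB Z1X Z2X; rewrite eB1 e12 eg.
  move=> /(congr1 (fun M => L2 *m M *m L1^T)).
  rewrite !mulmxDr !mulmxDl !mulmxA LB21 !mul0mx !add0r LB22 !mul1mx.
  rewrite -!mulmxA -trmx_mul LB11 trmx1 !mulmx1 => /esym gD1.
  suff -> : g = 1%:M by rewrite mulmx1.
  by rewrite -[g](mulmxK uD) gD1 mulmxV.
(* Now n = 3r and the three ranges are independent. The planes (Z1, Y) and
   (Z2, Y) are each flat, with factors of P Y differing by some g; the rank of
   P (Z1 + Z2 + Y) being r forces g = 1. *)
have [X [X0 [Z1X YX]]] := jf_common2 Z1 Y rn2.
have [B [linB eB1 hB]] := flat_on_kernel_from X0 Z10 Z1X uD e1.
have [X' [X'0 [Z2X' YX']]] := jf_common2 Z2 Y rn2.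
have [B' [linB' eB2 hB']] := flat_on_kernel_from X'0 Z20 Z2X' uD e2.
have e1Y := flat_polar linB hB Z1X YX.
have e2Y := flat_polar linB' hB' Z2X' YX'.
have eY := hB _ YX; rewrite {}eB1 in e1Y; rewrite {}eB2 in e2Y.
(* The matrix of rank at least [n] factors through these [3 * r <= n] columns, so they are
   independent. *)
have fS : row_full (row_mx B1 (row_mx B2 (B Y))).
  rewrite /row_full eqn_leq rank_leq_col.
  have eM : row_mx (P Z1) (row_mx (P Z2) (P Y)) = row_mx B1 (row_mx B2 (B Y)) *m
      block_mx (D *m B1^T) 0 0 (block_mx (D *m B2^T) 0 0 (D *m (B Y)^T)).
    by rewrite !mul_row_block !mulmx0 !addr0 !add0r !mulmxA -e1 -e2 -eY.
  by have := leq_trans rk _; rewrite eM; move/(_ _ (mxrankM_maxl _ _)); lia.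
have [L1 [L' [L11 L1' L'1 L'']]] := row_full_row_mx fS.
pose L2 := usubmx L'; pose L3 := dsubmx L'.
move: L1'; rewrite mul_mx_row -[0]hsubmxK => /eq_row_mx[]; rewrite !linear0.
move=> L12 L13; move: L'1; rewrite -[L']vsubmxK mul_col_mx -[0]vsubmxK.
move=> /eq_col_mx[]; rewrite !linear0 -/L2 -/L3 => L21 L31.
move: L''; rewrite -[L']vsubmxK mul_col_row scalar_mx_block -/L2 -/L3.
move=> /eq_block_mx[L22 L23 L32 L33].
have [L LB'] := jf_left_inv Y0 (hB' _ YX').
have [g eg gD] : exists2 g, B' Y = B Y *m g & g *m D *m g^T = D.
  by apply: (mulmx_form_factor LB' L33 uD); rewrite -eY hB'.
have trL (A : 'M[R]_(n, r)) (C : 'M_(r, n)) M : C *m A = M -> A^T *m C^T = M^T.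
  by move=> <-; rewrite trmx_mul.
pose N := P (Z1 + (Z2 + Y)).
have eN : N = P Z1 + (Pb Z1 Z2 + Pb Z1 Y) + (P Z2 + Pb Z2 Y + P Y).
  have PbD : Pb Z1 (Z2 + Y) = Pb Z1 Z2 + Pb Z1 Y.
    by have := jf_linear2 PbJ Z1 1 Z2 Y; rewrite !scale1r.
  by rewrite /N !jf_quadD PbD.
have L1N : L1 *m N = D *m (B1^T + B2^T + (B Y)^T).
  rewrite eN e1 e12 e1Y e2 e2Y eY eg !mulmxDr !mulmxA L11 L12 L13.
  by rewrite !mul0mx !mul1mx !addr0 addrA.
have L2N : L2 *m N = D *m (B1^T + B2^T + (B' Y)^T).
  rewrite eN e1 e12 e1Y e2 e2Y eY eg !mulmxDr !mulmxA L21 L22 L23.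
  by rewrite !mul0mx !mul1mx !addr0 !add0r addrA.
have L1NL1 : L1 *m N *m L1^T = D.
  rewrite L1N -mulmxA !mulmxDl (trL _ _ _ L11) (trL _ _ _ L12) (trL _ _ _ L13).
  by rewrite trmx1 !trmx0 !addr0 mulmx1.
have L2NL1 : L2 *m N *m L1^T = D.
  rewrite L2N eg trmx_mul -mulmxA !mulmxDl -(mulmxA g^T).
  rewrite (trL _ _ _ L11) (trL _ _ _ L12) (trL _ _ _ L13).
  by rewrite trmx1 !trmx0 mulmx0 !addr0 mulmx1.
have L1NL3 : L1 *m N *m L3^T = D.
  rewrite L1N -mulmxA !mulmxDl (trL _ _ _ L31) (trL _ _ _ L32) (trL _ _ _ L33).
  by rewrite trmx1 !trmx0 !add0r mulmx1.
have L2NL3 : L2 *m N *m L3^T = D *m g^T.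
  rewrite L2N eg trmx_mul -mulmxA !mulmxDl -(mulmxA g^T).
  rewrite (trL _ _ _ L31) (trL _ _ _ L32) (trL _ _ _ L33).
  by rewrite trmx1 !trmx0 !add0r mulmx1.
(* As [N] has rank at most [r] and [L1 *m N *m L1^T = D] is invertible, the Schur identity gives
   [L2 *m N *m L3^T = D]; the direct computation gives [D *m g^T]. *)
have := @mulmx_schur _ _ _ _ _ _ N L1 L1^T L2 L3^T (jf_rank_le _).
rewrite L1NL1 L2NL3 L2NL1 L1NL3 mulmxV // mul1mx => /(_ uD) Dg.
have g1 : g = 1%:M.
  by apply: trmx_inj; rewrite trmx1 -[LHS](mulKmx uD) Dg mulVmx.
by exists (B Y); split=> //; rewrite e2Y eg g1 mulmx1.
Qed.

(** The equations of [flat_extension] determine the factor by formulas linear in [Y]: [Pb Z2 Y]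
    yields [C Y = L1 *m B Y], then [Pb Z1 Y] yields [B Y]. Existence for each [Y] shows that these
    formulas give a factorization. *)
Theorem global_factorization : (0 < n)%N -> (3 * r <= n)%N ->
  exists (D : 'M_r) (B : 'rV_n -> 'M_(n, r)),
    [/\ D^T = D, D \in unitmx, linear B &
        forall Y, P Y = B Y *m D *m (B Y)^T].
Proof.
move=> n0 rn; have [Z1 [Z2 [D [B1 [B2 [[Z10 Z20 sD uD] [e1 e2 e12 fB]]]]]]] :=
  transversal_pair n0 rn.
have [L1 [L2 [L11 L12 L21 L22]]] := row_full_row_mx fB.
pose C Y := L1 *m Pb Z2 Y *m L2^T *m invmx D.
pose B Y := (Pb Z1 Y *m L1^T - B1 *m D *m (C Y)^T) *m invmx D.
have linC : linear C.
  move=> a Y Y'; rewrite /C (jf_linear2 PbJ) mulmxDr !mulmxDl.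
  by rewrite -scalemxAr -!scalemxAl.
exists D, B; split => //.
  move=> a Y Y'; rewrite /B (jf_linear2 PbJ) linC linearD linearZ /=.
  rewrite [X in X - _]mulmxDl -[X in X + _ - _]scalemxAl mulmxDr -scalemxAr.
  by rewrite [in RHS]scalemxAl -[RHS]mulmxDl scalerBr opprD addrACA.
move=> Y; have [B' [e1Y e2Y eY]] :=
  flat_extension Y n0 rn Z10 Z20 sD uD e1 e2 e12 fB.
suff -> : B Y = B' by [].
have eC : C Y = L1 *m B'.
  rewrite /C e2Y mulmxDr !mulmxA L12 !mul0mx add0r -(mulmxA _ B2^T) -trmx_mul L22.
  by rewrite trmx1 mulmx1 mulmxK.
rewrite /B eC e1Y [X in X - _]mulmxDl trmx_mul -(mulmxA _ B1^T) -(trmx_mul L1 B1) L11.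
rewrite trmx1 mulmx1.
by rewrite mulmxA addrC addKr mulmxK.
Qed.
End Gluing.

(** * Isospectral pencils *)

Lemma continuous_form (R : realType) r (H : 'M[R]_r) :
  continuous (fun x : 'rV[R]_r => (x *m H *m x^T) 0 0).
Proof.
have -> : (fun x : 'rV[R]_r => (x *m H *m x^T) 0 0) =
    (fun x : 'rV[R]_r => \sum_j (\sum_i x 0 i * H i j) * x 0 j).
  by apply/funext => x; rewrite mxE; apply: eq_bigr => j _; rewrite !mxE.
apply: continuous_big; first exact: add_continuous.
move=> j _ x; apply: continuousM; last exact: coord_continuous.
apply: continuous_big; first exact: add_continuous.
by move=> i _ y; apply: continuousM; [exact: coord_continuous|exact: cst_continuous].
Qed.

(** The Rayleigh quotient is homogeneous of degree 0 and continuous away from 0, so it attains its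
    maximum on the compact unit sphere of the ambient norm. *)
Lemma symmx_max_ratio (R : realType) r (G S : 'M[R]_r.+1) :
  (forall x : 'rV_r.+1, x != 0 -> 0 < (x *m G *m x^T) 0 0) ->
  exists (c : R) (v : 'rV_r.+1),
    [/\ v != 0, (v *m S *m v^T) 0 0 = c * (v *m G *m v^T) 0 0 &
        forall x : 'rV_r.+1, (x *m S *m x^T) 0 0 <= c * (x *m G *m x^T) 0 0].
Proof.
move=> pG.
pose q (H : 'M[R]_r.+1) (x : 'rV[R]_r.+1) : R := (x *m H *m x^T) 0 0.
pose A : set 'rV[R]_r.+1 := [set x | `|x| = 1]%classic.
have cA : compact A.
  apply: bounded_closed_compact.
    exists 1; split; first exact: num_real.
    by move=> M M1 x /= ->; exact: ltW.
  have /continuous_closedP : continuous (fun x : 'rV[R]_r.+1 => `|x|).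
    by move=> x; exact: norm_continuous.
  by move=> /(_ [set x | x = 1]%classic); apply; exact: closed_eq.
have An0 x : A x -> x != 0.
  by move=> Ax; rewrite -normr_eq0 Ax oner_eq0.
have nA (x : 'rV[R]_r.+1) : x != 0 -> A (`|x|^-1 *: x).
  by move=> x0; rewrite /A /= normrZ normfV normr_id mulVf // normr_eq0.
have A0 : (A !=set0)%classic.
  exists (`|const_mx 1 : 'rV[R]_r.+1|^-1 *: const_mx 1); apply: nA.
  by apply/eqP => /matrixP/(_ 0 0); rewrite !mxE => /eqP; rewrite oner_eq0.
have cf : {within A, continuous (fun x : 'rV[R]_r.+1 => q S x / q G x)}%classic.
  apply: continuous_in_subspaceT => x /set_mem /An0 x0.
  apply: continuousM; first exact: continuous_form.
  by apply: continuousV; [rewrite gt_eqF // pG|exact: continuous_form].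
have [v /set_mem /An0 v0 hv] := EVT_max_rV A0 cA cf.
exists (q S v / q G v), v; split => //.
  by rewrite divfK // gt_eqF ?pG.
move=> x; case: (eqVneq x 0) => [->|x0]; first by rewrite !mul0mx mxE mulr0.
have := hv _ (mem_set (nA x x0)).
have qZ H a : q H (a *: x) = a ^+ 2 * q H x.
  by rewrite /q linearZ /= -!scalemxAl -scalemxAr scalerA mxE.
rewrite !qZ -mulf_div divff ?mul1r; last first.
  by rewrite expf_neq0 // invr_eq0 normr_eq0.
by move=> le; rewrite -ler_pdivrMr //; exact: pG.
Qed.

Lemma dotvDl (R : realType) n (u v w : 'rV[R]_n) : dotv (u + v) w = dotv u w + dotv v w.
Proof. by rewrite /dotv mulmxDl mxE. Qed.

Lemma dotvZl (R : realType) n a (u w : 'rV[R]_n) : dotv (a *: u) w = a * dotv u w.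
Proof. by rewrite /dotv -scalemxAl mxE. Qed.

Lemma dotvNl (R : realType) n (u w : 'rV[R]_n) : dotv (- u) w = - dotv u w.
Proof. by rewrite -scaleN1r dotvZl mulN1r. Qed.

Lemma dotvC (R : realType) n (u w : 'rV[R]_n) : dotv u w = dotv w u.
Proof. by rewrite /dotv -[u *m _]trmxK trmx_mul trmxK mxE. Qed.

Lemma dotvDr (R : realType) n (u v w : 'rV[R]_n) : dotv w (u + v) = dotv w u + dotv w v.
Proof. by rewrite dotvC dotvDl !(dotvC w). Qed.

Lemma dotvZr (R : realType) n a (u w : 'rV[R]_n) : dotv w (a *: u) = a * dotv w u.
Proof. by rewrite dotvC dotvZl (dotvC w). Qed.

Lemma dotv_gt0 (R : realType) n (u : 'rV[R]_n) : u != 0 -> 0 < dotv u u.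
Proof.
move=> u0; have e : dotv u u = \sum_i u 0 i ^+ 2.
  by rewrite /dotv mxE; apply: eq_bigr => i _; rewrite mxE expr2.
rewrite lt_neqAle eq_sym e sumr_ge0 ?andbT => [|i _]; last exact: sqr_ge0.
apply: contra_neq u0; move=> /eqP; rewrite psumr_eq0 => [|i _]; last exact: sqr_ge0.
move=> /allP h; apply/matrixP => i j; rewrite ord1 mxE.
by have := h j (mem_index_enum _); rewrite sqrf_eq0 => /eqP.
Qed.

Lemma unit_vector_normalize (R : realType) n (u : 'rV[R]_n) :
  u != 0 -> unit_vector ((Num.sqrt (dotv u u))^-1 *: u).
Proof.
move=> /dotv_gt0 u0; rewrite /unit_vector dotvZl dotvZr mulrA -invfM -expr2.
by rewrite sqr_sqrtr ?ltW // mulVf // gt_eqF.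
Qed.

Lemma dotv_sumr (R : realType) n r (w : 'rV[R]_n) (F : 'I_r -> 'rV_n) :
  dotv w (\sum_i F i) = \sum_i dotv w (F i).
Proof.
apply: (big_morph (dotv w)) => [u v|]; first exact: dotvDr.
by rewrite /dotv trmx0 mulmx0 mxE.
Qed.

Lemma unit_vector_neq0 (R : realType) n (X : 'rV[R]_n) : unit_vector X -> X != 0.
Proof.
by move=> uX; apply: contra_eq_neq uX => ->; rewrite /dotv mul0mx mxE eq_sym oner_eq0.
Qed.

Lemma unit_vector_delta (R : realType) n (i : 'I_n) :
  unit_vector (delta_mx 0 i : 'rV[R]_n).
Proof. by rewrite /unit_vector /dotv trmx_delta mul_delta_mx mxE !eqxx. Qed.

(** If [w = v *m H] were nonzero, the form at [v + t *: w] would be negative for small negative [t],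
    its linear term being [2 t |w|^2]. *)
Lemma psdmx_isotropic (R : realType) r (H : 'M[R]_r) (v : 'rV_r) :
  H^T = H -> (forall x : 'rV_r, 0 <= (x *m H *m x^T) 0 0) ->
  (v *m H *m v^T) 0 0 = 0 -> v *m H = 0.
Proof.
move=> sH pH v0; apply/eqP/negPn/negP => vH; have a0 := dotv_gt0 vH.
set w := v *m H in vH a0.
have h t : 0 <= t * (dotv w w *+ 2) + t ^+ 2 * (w *m H *m w^T) 0 0.
  have wHv : w *m H *m v^T = w *m w^T by rewrite -mulmxA -{1}sH -trmx_mul.
  have D (A B : 'M[R]_1) : (A + B) 0 0 = A 0 0 + B 0 0 by rewrite mxE.
  have Z a (A : 'M[R]_1) : (a *: A) 0 0 = a * A 0 0 by rewrite mxE.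
  have := pH (v + t *: w).
  rewrite linearD linearZ /= !mulmxDl !mulmxDr -!scalemxAl -!scalemxAr scalerA wHv.
  by rewrite -/w !D !Z v0 /dotv; lra.
have b0 := pH w; move: (_ 0 0) b0 h => b b0 h.
(* The 1 added to [b] keeps the denominator positive when [b = 0]. *)
have := h (- dotv w w / (b + 1)); move: (dotv w w) a0 => a a0.
have b1 : 0 < b + 1 by lra.
have -> : - a / (b + 1) * (a *+ 2) + (- a / (b + 1)) ^+ 2 * b
  = - (a ^+ 2 * (b + 2) / (b + 1) ^+ 2).
  by field; rewrite gt_eqF.
rewrite oppr_ge0 leNgt divr_gt0 ?mulr_gt0 ?exprn_gt0 //; lra.
Qed.

Lemma common_left_kernel (F : fieldType) n r k (s : seq 'M[F]_(n, r)) :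
  (forall A, A \in s -> (\rank A <= k)%N) -> (size s * k < n)%N ->
  exists2 u : 'rV_n, u != 0 & forall A, A \in s -> u *m A = 0.
Proof.
move=> rs sn.
suff [U rU hU] : exists2 U : 'M_n, (n - size s * k <= \rank U)%N &
    forall A, A \in s -> U *m A = 0.
  have : U != 0 by rewrite -mxrank_eq0 -lt0n (leq_trans _ rU) // subn_gt0.
  move=> /rowV0Pn[u /submxP[x ->] u0]; exists (x *m U) => // A As.
  by rewrite -mulmxA hU // mulmx0.
elim: s rs {sn} => [_|A s IHs rs]; first by exists 1%:M; rewrite ?mxrank1 ?leq_subr.
have [B Bs|U rU hU] := IHs; first by apply: rs; rewrite inE Bs orbT.
exists (U :&: kermx A)%MS.
  have := mxrank_sum_cap U (kermx A); rewrite mxrank_ker.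
  have := rank_leq_col (U + kermx A)%MS; have := rs A (mem_head _ _).
  by rewrite /=; lia.
move=> B; rewrite inE => /orP[/eqP ->|Bs]; first exact/sub_kermxP/capmxSr.
by have /submxP[x ->] := capmxSl U (kermx A); rewrite -mulmxA hU // mulmx0.
Qed.

Lemma row_free_exists (F : fieldType) m n k (A : 'M[F]_(m, n)) :
  \rank A = k -> exists W : 'M_(k, n), row_free W /\ (W :=: A)%MS.
Proof.
move=> <-; exists (row_base A).
by split; [exact: row_base_free|exact: eq_row_base].
Qed.

(* The spectrum of S relative to the inner product quad Gb Y is the same, with
   multiplicities, for all unit vectors Y. *)
Record isospectral_pencil (R : realType) n r
    (Gb : 'rV[R]_n -> 'rV[R]_n -> 'M[R]_r) (S : 'M[R]_r) : Prop := IsospectralPencil {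
  ip_linear : forall a X X' Y, Gb (a *: X + X') Y = a *: Gb X Y + Gb X' Y;
  ip_sym : forall X Y, Gb X Y = Gb Y X;
  ip_tr : forall X Y, (Gb X Y)^T = Gb X Y;
  ip_trS : S^T = S;
  ip_pos : forall Y (x : 'rV_r), Y != 0 -> x != 0 -> 0 < (x *m quad Gb Y *m x^T) 0 0;
  ip_rank : forall c Y Y', unit_vector Y -> unit_vector Y' ->
    \rank (S - c *: quad Gb Y) = \rank (S - c *: quad Gb Y')
}.

Section CommonEigenvector.
Variables (R : realType) (n r : nat).
Variables (Gb : 'rV[R]_n -> 'rV[R]_n -> 'M[R]_r.+1) (S : 'M[R]_r.+1).
Hypothesis GS : isospectral_pencil Gb S.
Local Notation G := (quad Gb).

(** [c] is the largest eigenvalue at [Y0]. By isospectrality the largest eigenvalue at any other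
    unit vector is also an eigenvalue at [Y0], hence at most [c]; homogeneity covers the remaining
    [Y]. *)
Lemma ip_max_eigenvalue (Y0 : 'rV_n) : unit_vector Y0 ->
  exists (c : R) (v : 'rV_r.+1), [/\ v != 0, v *m S = c *: (v *m G Y0) &
    forall Y (x : 'rV_r.+1),
      0 <= (x *m (c *: G Y - dotv Y Y *: S) *m x^T) 0 0].
Proof.
have ex Y : unit_vector Y -> exists (c : R) (v : 'rV_r.+1),
    [/\ v != 0, v *m S = c *: (v *m G Y) &
      forall x : 'rV_r.+1, (x *m S *m x^T) 0 0 <= c * (x *m G Y *m x^T) 0 0].
  move=> uY; have [c [v [v0 ev hc]]] := symmx_max_ratio S
    (fun x => ip_pos GS (x := x) (unit_vector_neq0 uY)).
  exists c, v; split=> //; apply/eqP.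
  have trH : (c *: G Y - S)^T = c *: G Y - S.
    by rewrite linearB linearZ /= (ip_trS GS) /quad linearZ /= (ip_tr GS).
  have qH (x : 'rV_r.+1) : (x *m (c *: G Y - S) *m x^T) 0 0
      = c * (x *m G Y *m x^T) 0 0 - (x *m S *m x^T) 0 0.
    rewrite mulmxBr mulmxBl -(scalemxAr c) -scalemxAl.
    by rewrite [LHS]mxE [X in X + _]mxE [X in _ + X]mxE.
  have : v *m (c *: G Y - S) = 0.
    by apply: psdmx_isotropic => // [x|]; rewrite qH ?ev ?subrr // subr_ge0.
  by rewrite mulmxBr -(scalemxAr c) => /subr0_eq ->.
move=> uY0; have [c [v [v0 vS hc]]] := ex Y0 uY0.
exists c, v; split=> // Y x.
have hcu Y' (y : 'rV_r.+1) : unit_vector Y' ->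
    (y *m S *m y^T) 0 0 <= c * (y *m G Y' *m y^T) 0 0.
  move=> uY'; have [c' [v' [v'0 v'S hc']]] := ex Y' uY'.
  apply: (le_trans (hc' y)); suff cc' : c' <= c.
    case: (eqVneq y 0) => [->|y0]; first by rewrite !mul0mx !mxE !mulr0.
    by rewrite ler_pM2r // (ip_pos GS) // unit_vector_neq0.
  have [u u0 uS] : exists2 u : 'rV_r.+1, u != 0 & u *m (S - c' *: G Y0) = 0.
    apply: left_kernel_neq0; rewrite (ip_rank GS _ uY0 uY').
    rewrite ltn_neqAle rank_leq_row andbT; apply/negP => fr.
    case/eqP: v'0; apply: (row_free_inj fr).
    by rewrite mul0mx mulmxBr v'S -(scalemxAr c') subrr.
  move: uS; rewrite mulmxBr -(scalemxAr c') => /subr0_eq uS.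
  have := hc u; rewrite uS -scalemxAl [X in X <= _]mxE.
  by rewrite ler_pM2r // (ip_pos GS) // unit_vector_neq0.
case: (eqVneq Y 0) => [->|Y0'].
  rewrite (quad0 (ip_linear GS)).
  have -> : dotv (0 : 'rV[R]_n) 0 = 0 by rewrite /dotv mul0mx mxE.
  by rewrite scale0r scaler0 subr0 mulmx0 mul0mx mxE.
have := hcu _ x (unit_vector_normalize Y0'); set a := Num.sqrt _.
have a0 : 0 < a by rewrite sqrtr_gt0 dotv_gt0.
have -> : dotv Y Y = a ^+ 2 by rewrite sqr_sqrtr // ltW // dotv_gt0.
rewrite (quadZ (ip_linear GS) (ip_sym GS)) mulmxBr mulmxBl.
rewrite -(scalemxAr (_ ^+ 2)) -(scalemxAr c).
rewrite -(scalemxAr (a ^+ 2)) -!scalemxAl.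
rewrite [X in _ <= _ * X]mxE [X in 0 <= X]mxE [X in 0 <= X + _]mxE [X in 0 <= _ + X]mxE.
rewrite [X in 0 <= _ - X]mxE subr_ge0 exprVn mulrCA => h.
by rewrite -ler_pdivlMl ?exprn_gt0.
Qed.
End CommonEigenvector.

Section ConstantKernel.
Variables (R : realType) (n r : nat) (Hb : 'rV[R]_n -> 'rV[R]_n -> 'M[R]_r) (k : nat).
Local Notation H := (quad Hb).
Hypothesis lH : forall a X X' Y, Hb (a *: X + X') Y = a *: Hb X Y + Hb X' Y.
Hypothesis symH : forall X Y, Hb X Y = Hb Y X.
Hypothesis trH : forall X Y, (Hb X Y)^T = Hb X Y.
Hypothesis psdH : forall Y (x : 'rV_r), 0 <= (x *m H Y *m x^T) 0 0.
Hypothesis rkH : forall Y, Y != 0 -> \rank (H Y) = k.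

Let trQ X : (H X)^T = H X.
Proof. by rewrite /quad linearZ /= trH. Qed.

Let rk X Y t : X != 0 ->
  (\rank (H X + t *: Hb X Y + t ^+ 2 *: H Y)%R <= \rank (H X))%N.
Proof.
move=> X0; rewrite -quad_line // (rkH X0); case: (eqVneq (X + t *: Y) 0) => [->|].
  by rewrite quad0 // mxrank0.
by move=> /rkH ->.
Qed.

(** With zero first order term, the second order rank condition makes [v] isotropic for [H Y], and
    semidefiniteness puts it in the kernel. *)
Lemma psd_kernel_ext X (v : 'rV_r) Y : X != 0 -> v *m H X = 0 -> v *m Hb X Y = 0 ->
  v *m H Y = 0.
Proof.
move=> X0 vX vXY; apply: psdmx_isotropic => //.
have tv A : A^T = A -> v *m A = 0 -> A *m v^T = 0.
  by move=> sA vA; rewrite -sA -trmx_mul vA trmx0.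
have := rank_perturb2 (M1 := Hb X Y) (M2 := H Y) (fun t => rk Y t X0)
  (u := v) (y := 0) (w := v^T) (z := 0) vX.
by rewrite mul0mx mulmx0 mul0mx vXY !tv // => -> //; rewrite mxE.
Qed.

(** By the first order rank condition every [v *m Hb X Y] is orthogonal to [ker (H X)], which leaves
    a space of dimension [k]. *)
Lemma kernel_ext_rank X (v : 'rV_r) : X != 0 -> v *m H X = 0 ->
  (\rank (lin1_mx (fun Y => v *m Hb X Y)) <= k)%N.
Proof.
move=> X0 vX.
have L0 : lin1_mx (fun Y => v *m Hb X Y) *m (kermx (H X))^T = 0.
  apply: mulmx_rV_ext => Y; rewrite mulmxA mul_rV_linear1 ?mulmx0; last first.
    by move=> a Z Z'; rewrite !(symH X) lH mulmxDr -scalemxAr.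
  apply: (rank_perturb1 (M2 := H Y) (fun t => rk Y t X0)) => //.
  by rewrite -{1}trQ -trmx_mul mulmx_ker trmx0.
have := mulmx0_rank_max L0; rewrite mxrank_tr mxrank_ker (rkH X0).
by have := rank_leq_row (H X); rewrite (rkH X0); lia.
Qed.

(* For v in ker (H X) the space of Z with v in ker (H Z) has codimension at most
   k. If the kernel varied, it would be possible to find a nonzero Z with
   r - k + 1 independent vectors in ker (H Z). *)
Lemma psd_kernel_const X Y (v : 'rV_r) : ((r - k).+1 * k < n)%N ->
  X != 0 -> v *m H X = 0 -> v *m H Y = 0.
Proof.
move=> kn X0 vX; case: (eqVneq Y 0) => [->|Y0].
  by rewrite quad0 // mulmx0.
have rK : \rank (kermx (H Y)) = (r - k)%N by rewrite mxrank_ker rkH.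
have [W [_ WE]] := row_free_exists rK.
pose L Z u := lin1_mx (fun Y => u *m Hb Z Y).
have WY i : row i W *m H Y = 0.
  by apply/sub_kermxP; rewrite -WE row_sub.
(* One condition for [v] and [r - k] for the basis [W] of [ker (H Y)], each of rank at most [k]:
   this is where [(r - k).+1 * k < n] enters. *)
have [||Z Z0 hZ] := @common_left_kernel _ _ _ k
  (L X v :: [seq L Y (row i W) | i <- enum 'I_(r - k)]).
- move=> A; rewrite inE => /orP[/eqP ->|/mapP[i _ ->]]; exact: kernel_ext_rank.
- by rewrite /= size_map size_enum_ord.
have LE Z' u : Z *m L Z' u = u *m Hb Z' Z.
  by apply: mul_rV_linear1 => a T T'; rewrite !(symH Z') lH mulmxDr -scalemxAr.
have vZ : v *m H Z = 0.
  by apply: (psd_kernel_ext X0 vX); rewrite -LE hZ // mem_head.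
have WZ : W *m H Z = 0.
  apply/row_matrixP => i; rewrite row_mul row0.
  apply: (psd_kernel_ext Y0 (WY i)); rewrite -LE hZ // inE; apply/orP; right.
  by apply/mapP; exists i; rewrite ?mem_enum.
apply/sub_kermxP; rewrite -WE.
have : (W + v <= W)%MS.
  rewrite -(mxrank_leqif_sup (addsmxSl W v)) eqn_leq mxrankS ?addsmxSl //=.
  have WvZ : (W + v <= kermx (H Z))%MS.
    by rewrite addsmx_sub; apply/andP; split; apply/sub_kermxP.
  by rewrite (leq_trans (mxrankS WvZ)) // mxrank_ker rkH // WE rK.
by rewrite addsmx_sub => /andP[].
Qed.
End ConstantKernel.

(** For the largest eigenvalue [c], the family [c *: quad Gb Y - dotv Y Y *: S] is positive
    semidefinite and, by isospectrality, of constant rank off 0. Its kernel is therefore constant,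
    and contains [v]. *)
Lemma pencil_common_eigenvector (R : realType) n r
    (Gb : 'rV[R]_n -> 'rV[R]_n -> 'M[R]_r.+1) S :
  isospectral_pencil Gb S -> S \in unitmx -> (r.+2 ^ 2 < 4 * n)%N ->
  exists (c : R) (v : 'rV_r.+1), [/\ v != 0, c != 0 &
    forall Y, c *: (v *m quad Gb Y) = dotv Y Y *: (v *m S)].
Proof.
move=> GS uS rn; have n0 : (0 < n)%N by lia.
pose Y0 : 'rV[R]_n := delta_mx 0 (Ordinal n0).
have uY0 : unit_vector Y0 := unit_vector_delta R _.
have Y00 := unit_vector_neq0 uY0.
have [c [v [v0 vS pH]]] := ip_max_eigenvalue GS uY0.
pose Hb X Y := c *: Gb X Y - (2 * dotv X Y) *: S.
have HE Y : quad Hb Y = c *: quad Gb Y - dotv Y Y *: S.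
  by rewrite /quad /Hb; apply/matrixP => i j; rewrite !mxE; field.
have trG Y : (quad Gb Y)^T = quad Gb Y by rewrite /quad linearZ /= (ip_tr GS).
have c0 : c != 0.
  apply: contra_neq v0 => c0; move: vS; rewrite c0 scale0r => vS.
  by rewrite -[v](mulmxK uS) vS mul0mx.
have rH Y : Y != 0 -> \rank (quad Hb Y) = \rank (quad Hb Y0).
  move=> Yn0; have uY := unit_vector_normalize Yn0; set a := Num.sqrt _ in uY.
  have a0 : a != 0 by rewrite sqrtr_eq0 -ltNge dotv_gt0.
  have e Z : unit_vector Z -> \rank (quad Hb Z) = \rank (S - c *: quad Gb Z).
    by move=> uZ; rewrite HE uZ scale1r -mxrank_opp opprB.
  have -> : quad Hb Y = a ^+ 2 *: quad Hb (a^-1 *: Y).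
    rewrite !HE (quadZ (ip_linear GS) (ip_sym GS)) dotvZl dotvZr.
    by apply/matrixP => i j; rewrite !mxE; field.
  by rewrite mxrank_scale_nz ?expf_neq0 // !e // (ip_rank GS _ uY uY0).
have vH : v *m quad Hb Y0 = 0.
  by rewrite HE mulmxBr -(scalemxAr c) -(scalemxAr (dotv _ _)) vS uY0 scale1r subrr.
exists c, v; split=> // Y.
have : v *m quad Hb Y = 0.
  apply: (@psd_kernel_const _ _ _ Hb (\rank (quad Hb Y0)) _ _ _ _ _ Y0) => //.
  - move=> a X X' Z; rewrite /Hb (ip_linear GS) dotvDl dotvZl.
    by apply/matrixP => i j; rewrite !mxE; ring.
  - by move=> X Z; rewrite /Hb (ip_sym GS) dotvC.
  - by move=> X Z; rewrite /Hb linearB !linearZ /= (ip_tr GS) (ip_trS GS).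
  - by move=> Z x; rewrite HE.
  (* The factors [(r.+1 - k).+1] and [k] sum to [r.+2], so by AM-GM four times their product is at
     most [r.+2 ^ 2 < 4 * n]. *)
  have := rank_leq_row (quad Hb Y0); move: (\rank _) => k kr.
  have e : ((r.+1 - k).+1 + k = r.+2)%N by lia.
  by have := (nat_AGM2 (r.+1 - k).+1 k).1; rewrite e; lia.
by rewrite HE mulmxBr -(scalemxAr c) -(scalemxAr (dotv _ _)) => /subr0_eq.
Qed.

(** Deflation: each [v *m quad Gb Y] is proportional to [v *m S], so on the [S]-orthogonal
    complement [W] of [v] the whole family splits off the line of [v], and the restricted pencil is
    again isospectral. *)
Lemma pencil_diag (R : realType) n r
    (Gb : 'rV[R]_n -> 'rV[R]_n -> 'M[R]_r) S :
  isospectral_pencil Gb S -> S \in unitmx -> (r.+1 ^ 2 < 4 * n)%N ->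
  exists (C : 'M_r) (d : 'rV_r), C *m S *m C^T = diag_mx d /\
    forall Y, C *m quad Gb Y *m C^T = (dotv Y Y)%:M.
Proof.
elim: r Gb S => [|r IHr] Gb S GS uS rn.
  by exists 0, 0; split=> [|Y]; apply/matrixP => -[].
have [c [v0 [v00 c0 hv0]]] := pencil_common_eigenvector GS uS rn.
have n0 : (0 < n)%N by lia.
pose Y0 : 'rV[R]_n := delta_mx 0 (Ordinal n0).
have uY0 : unit_vector Y0 := unit_vector_delta R _.
have Y00 := unit_vector_neq0 uY0.
have := ip_pos GS Y00 v00; set b := (_ *m _) 0 0 => b0.
pose v := (Num.sqrt b)^-1 *: v0.
have hv Y : c *: (v *m quad Gb Y) = dotv Y Y *: (v *m S).
  by rewrite /v -!(scalemxAl _ v0) scalerA mulrC -scalerA hv0 !scalerA mulrC.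
have vGv0 : v *m quad Gb Y0 *m v^T = 1%:M.
  have -> : v^T = (Num.sqrt b)^-1 *: v0^T by rewrite linearZ.
  rewrite /v -2!scalemxAl -scalemxAr scalerA -invfM -expr2.
  rewrite sqr_sqrtr ?ltW // [_ *m _]mx11_scalar -/b scale_scalar_mx mulVf //.
  by rewrite gt_eqF.
move: v hv vGv0 => v hv vGv0.
have vSv : v *m S *m v^T = c%:M.
  have := congr1 (fun M => M *m v^T) (hv Y0).
  by rewrite uY0 scale1r -scalemxAl vGv0 scalemx1.
have rK : \rank (kermx (S *m v^T)) = r.
  have : S *m v^T != 0.
    apply: contra_neq c0 => Sv; move: vSv; rewrite -mulmxA Sv mulmx0.
    by move/matrixP/(_ 0 0); rewrite !mxE.
  rewrite mxrank_ker -mxrank_eq0; have := rank_leq_col (S *m v^T).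
  by case: (\rank _) => [|[|]] //; rewrite subn1.
have [W [fW WE]] := row_free_exists rK.
have WSv : W *m S *m v^T = 0.
  by apply/eqP; rewrite -mulmxA -sub_kermx WE.
pose V : 'M[R]_(1 + r, r.+1) := col_mx v W.
have trG Y : (quad Gb Y)^T = quad Gb Y by rewrite /quad linearZ /= (ip_tr GS).
have vSW : v *m S *m W^T = 0.
  by apply: trmx_inj; rewrite trmx0 !trmx_mul trmxK (ip_trS GS) mulmxA.
have vGv Y : v *m quad Gb Y *m v^T = (dotv Y Y)%:M.
  have := congr1 (fun M => c^-1 *: (M *m v^T)) (hv Y).
  rewrite -!scalemxAl vSv scalerA mulVf // scale1r => ->.
  by rewrite scale_scalar_mx scale_scalar_mx mulrCA mulVf // mulr1.
have vGW Y : v *m quad Gb Y *m W^T = 0.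
  have := congr1 (fun M => c^-1 *: (M *m W^T)) (hv Y).
  by rewrite -!scalemxAl vSW scalerA mulVf // scale1r !scaler0.
have WGv Y : W *m quad Gb Y *m v^T = 0.
  by apply: trmx_inj; rewrite trmx0 !trmx_mul trmxK trG mulmxA.
have VSV : V *m S *m V^T = block_mx (c%:M : 'M_1) 0 0 (W *m S *m W^T).
  rewrite /V tr_col_mx mul_col_mx mul_col_row.
  by rewrite vSv vSW WSv.
have VGV Y : V *m quad Gb Y *m V^T
    = block_mx ((dotv Y Y)%:M : 'M_1) 0 0 (W *m quad Gb Y *m W^T).
  by rewrite /V tr_col_mx mul_col_mx mul_col_row vGv vGW WGv.
(* Pairing a linear relation with [S *m v^T] kills the part in [W] and leaves [c] times the
   coefficient of [v]. *)
have uV : (V : 'M_r.+1) \in unitmx.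
  rewrite -row_free_unit -kermx_eq0.
  have := mulmx_ker V; move: (kermx V) => K; rewrite -[K](@hsubmxK _ _ 1 r).
  rewrite mul_row_col => e; have := congr1 (fun M => M *m S *m v^T) e.
  rewrite !mulmxDl -!mulmxA (mulmxA v) vSv (mulmxA W) WSv mulmx0 addr0 !mul0mx.
  rewrite mul_mx_scalar => /eqP; rewrite scaler_eq0 (negPf c0) /= => /eqP K1.
  move: e; rewrite K1 mul0mx add0r => /eqP; rewrite mulmx_free_eq0 // => /eqP ->.
  by rewrite row_mx0.
have rkV A : \rank (V *m A *m V^T) = \rank A.
  by rewrite mxrankMfree ?row_free_unit ?unitmx_tr // eqmxMfull // row_full_unit.
pose Gb' X Y := W *m Gb X Y *m W^T.
have qG' Y : quad Gb' Y = W *m quad Gb Y *m W^T.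
  by rewrite /quad /Gb' -scalemxAr -scalemxAl.
have uS' : W *m S *m W^T \in unitmx.
  have := rkV S; rewrite VSV rank_diag_block_mx (mxrank_unit uS) => e.
  rewrite -row_free_unit /row_free; have := rank_leq_row (W *m S *m W^T).
  by have := rank_leq_row (c%:M : 'M[R]_1); lia.
have GS' : isospectral_pencil Gb' (W *m S *m W^T).
  split.
  - by move=> a X X' Y; rewrite /Gb' (ip_linear GS) mulmxDr mulmxDl -scalemxAr -scalemxAl.
  - by move=> X Y; rewrite /Gb' (ip_sym GS).
  - by move=> X Y; rewrite /Gb' !trmx_mul trmxK (ip_tr GS) mulmxA.
  - by rewrite !trmx_mul trmxK (ip_trS GS) mulmxA.
  - move=> Y x Yn0 x0; rewrite qG'.
    have -> : x *m (W *m quad Gb Y *m W^T) *m x^T = (x *m W) *m quad Gb Y *m (x *m W)^T.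
      by rewrite trmx_mul !mulmxA.
    by apply: (ip_pos GS Yn0); rewrite mulmx_free_eq0.
  - move=> a.
    (* The block of [v] contributes the rank of [c - a], the same for all unit [Y], and cancels. *)
    have e Y : unit_vector Y -> \rank (S - a *: quad Gb Y)
        = (\rank ((c - a)%:M : 'M[R]_1)%R
           + \rank (W *m S *m W^T - a *: quad Gb' Y)%R)%N.
      move=> uY; rewrite -(rkV (S - _)) -rank_diag_block_mx; congr mxrank.
      rewrite mulmxBr mulmxBl -(scalemxAr a) -(scalemxAl a) VSV VGV uY qG'.
      rewrite scale_block_mx opp_block_mx add_block_mx !scaler0 !subr0.
      by rewrite scale_scalar_mx mulr1 -raddfB.
    move=> Y Y' uY uY'; have := ip_rank GS a uY uY'; rewrite !e //.
    exact: addnI.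
have rn' : (r.+1 ^ 2 < 4 * n)%N by apply: leq_ltn_trans rn; rewrite leq_sqr.
have [C [d [CS CG]]] := IHr _ _ GS' uS' rn'.
pose E : 'M[R]_(1 + r) := block_mx 1%:M 0 0 C.
exists (E *m V), (row_mx (c%:M : 'M_1) d).
have bE A : E *m V *m A *m (E *m V)^T = E *m (V *m A *m V^T) *m E^T.
  by rewrite trmx_mul !mulmxA.
have Ebl x A : E *m block_mx (x%:M : 'M_1) 0 0 A *m E^T
    = block_mx x%:M 0 0 (C *m A *m C^T).
  rewrite /E tr_block_mx !trmx0 trmx1 !mulmx_block.
  by rewrite !(mul0mx, mulmx0, addr0, add0r) mul1mx mulmx1.
split=> [|Y].
  rewrite bE VSV Ebl CS; apply: etrans (esym (@diag_mx_row _ r 1 c%:M d)).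
  by congr block_mx; apply/matrixP => i j; rewrite !ord1 !mxE.
rewrite bE VGV Ebl -qG' CG.
exact: (esym (@scalar_mx_block _ 1 r (dotv Y Y))).
Qed.

(** * The shifted Jacobi operator *)

Lemma dotv_trmx (R : realType) n (A : 'M[R]_n) u v :
  dotv (u *m A) v = dotv u (v *m A^T).
Proof. by rewrite /dotv trmx_mul trmxK mulmxA. Qed.

Lemma symmx_dotv (R : realType) n (A : 'M[R]_n) :
  (forall u v, dotv (u *m A) v = dotv (v *m A) u) -> A^T = A.
Proof.
move=> sA; apply/matrixP => i j; rewrite mxE.
have e k l : dotv (delta_mx 0 k *m A) (delta_mx 0 l) = A k l.
  by rewrite /dotv -rowE trmx_delta -colE !mxE.
by rewrite -!e.
Qed.

Section ShiftedJacobi.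
Variables (R : realType) (n : nat) (T : tensor31 R n) (l : R).
Hypothesis hT : algebraic_curvature_tensor T.

(* The polarization of X |-> R_X - l (|X|^2 - X X^T), an operator vanishing on X
   and equal to R_X - l on the orthogonal complement of a unit vector X. *)
Definition shifted_jacobi (X Y : 'rV[R]_n) : 'M[R]_n :=
  lin1_mx (fun Z => T X Z Y + T Y Z X)
  - l *: ((2 * dotv X Y)%:M - (X^T *m Y + Y^T *m X)).

Local Notation Pb := shifted_jacobi.
Local Notation P := (quad Pb).

Lemma shifted_jacobiE X Y Z : Z *m Pb X Y =
  T X Z Y + T Y Z X - l *: ((2 * dotv X Y) *: Z - (dotv Z X *: Y + dotv Z Y *: X)).
Proof.
rewrite /shifted_jacobi mulmxBr mul_rV_linear1; last first.
  move=> a V W; rewrite (act_linear2 hT) [T Y _ X](act_linear2 hT).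
  by rewrite scalerDr addrACA.
rewrite -scalemxAr mulmxBr mul_mx_scalar mulmxDr !mulmxA.
by rewrite [Z *m X^T]mx11_scalar [Z *m Y^T]mx11_scalar !mul_scalar_mx.
Qed.

Lemma act_diag X Y : T X X Y = 0.
Proof.
have /eqP := act_skew12 hT X X Y.
by rewrite -addr_eq0 -mulr2n -scaler_nat scaler_eq0 pnatr_eq0 => /eqP.
Qed.

Lemma quad_shifted_jacobiE X Z : Z *m P X =
  T X Z X - l *: (dotv X X *: Z - dotv Z X *: X).
Proof.
rewrite /quad -scalemxAr shifted_jacobiE; apply/matrixP => i j; rewrite !mxE.
by move: (T X Z X) => V; field.
Qed.


Lemma shifted_jacobi_linear a X X' Y : Pb (a *: X + X') Y = a *: Pb X Y + Pb X' Y.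
Proof.
apply: mulmx_rV_ext => Z; rewrite [RHS]mulmxDr -(scalemxAr a) !shifted_jacobiE.
rewrite (act_linear1 hT) (act_linear3 hT) !(dotvDl, dotvDr, dotvZl, dotvZr).
move: (T X Z Y) (T X' Z Y) (T Y Z X) (T Y Z X') => A A' B B'.
by apply/matrixP => i j; rewrite !mxE; ring.
Qed.

Lemma shifted_jacobi_sym X Y : Pb X Y = Pb Y X.
Proof.
apply: mulmx_rV_ext => Z; rewrite !shifted_jacobiE dotvC.
by congr (_ - _ *: (_ - _)); rewrite addrC.
Qed.

Lemma shifted_jacobi_tr X Y : (Pb X Y)^T = Pb X Y.
Proof.
apply: symmx_dotv => u v; rewrite !shifted_jacobiE.
rewrite !(dotvDl, dotvNl, dotvZl).
rewrite (act_pair_sym hT X u Y v) (act_pair_sym hT Y u X v).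
by rewrite (dotvC u v) (dotvC v X) (dotvC v Y) (dotvC u X) (dotvC u Y); ring.
Qed.

Lemma shifted_jacobi_swap X Y : X *m P Y *m X^T = Y *m P X *m Y^T.
Proof.
apply/matrixP => i j; rewrite !ord1 -!/(dotv _ _) !quad_shifted_jacobiE.
rewrite !(dotvDl, dotvNl, dotvZl).
have -> : dotv (T Y X Y) X = dotv (T X Y X) Y.
  by rewrite (act_skew12 hT) -scaleN1r dotvZl mulN1r (act_skew34 hT) opprK.
by rewrite (dotvC X Y); ring.
Qed.

Lemma shifted_jacobi_self X : X *m P X = 0.
Proof. by rewrite quad_shifted_jacobiE act_diag subrr scaler0 subrr. Qed.

Lemma jacobiE X Z : Z *m jacobi T X = T X Z X.
Proof. by apply: mul_rV_linear1 => a Y Y'; rewrite (act_linear2 hT). Qed.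

Lemma sub_eigenspace_jacobi X a (u : 'rV_n) : unit_vector X ->
  reflect (u *m P X = (a - l) *: u /\ dotv u X = 0)
    (u <= eigenspace (jacobi T X) a :&: kermx X^T)%MS.
Proof.
move=> uX; rewrite sub_capmx.
have e : dotv u X = 0 -> u *m P X = u *m jacobi T X - l *: u.
  by move=> uX0; rewrite quad_shifted_jacobiE jacobiE uX uX0 scale1r scale0r subr0.
apply: (iffP andP) => [[/eigenspaceP ua /sub_kermxP uX0]|[uP uX0]].
  have uX1 : dotv u X = 0 by rewrite /dotv uX0 mxE.
  by split=> //; rewrite e // ua scalerBl.
split; last by apply/sub_kermxP; rewrite [LHS]mx11_scalar -/(dotv _ _) uX0 raddf0.
by apply/eigenspaceP; move: uP; rewrite e // scalerBl => /addIr.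
Qed.

(** The kernel is the direct sum of the line of [X] and the eigenspace of [l] inside the orthogonal
    complement of [X]. *)
Lemma rank_shifted_jacobi X : unit_vector X ->
  \rank (P X) = (n - 1 - jacobi_mult T X l)%N.
Proof.
move=> uX; set U := (eigenspace (jacobi T X) l :&: kermx X^T)%MS.
have X0 := unit_vector_neq0 uX.
have UP (u : 'rV_n) : (u <= U)%MS <-> u *m P X = 0 /\ dotv u X = 0.
  have := sub_eigenspace_jacobi l u uX; rewrite subrr scale0r.
  by move=> h; split=> [/h|h'] //; apply/h.
have dXU : (X :&: U = 0)%MS.
  apply/eqP/rowV0P => u; rewrite sub_capmx => /andP[/sub_rVP[a ->] /UP[_]].
  by rewrite dotvZl uX mulr1 => ->; rewrite scale0r.
have kE : (kermx (P X) :=: X + U)%MS.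
  apply/eqmxP/andP; split; last first.
    rewrite addsmx_sub; apply/andP; split.
      by apply/sub_kermxP; exact: shifted_jacobi_self.
    by apply/rV_subP => u /UP[uP _]; apply/sub_kermxP.
  apply/rV_subP => u /sub_kermxP uP.
  rewrite -[u](subrK (dotv u X *: X)) addrC addmx_sub_adds ?scalemx_sub //.
  apply/UP; rewrite mulmxBl -scalemxAl uP shifted_jacobi_self scaler0 subrr.
  by rewrite -scaleNr dotvDl dotvZl uX mulr1 subrr.
have := mxrank_ker (P X); rewrite kE mxrank_disjoint_sum // rank_rV X0.
have := rank_leq_row (P X); rewrite /jacobi_mult -/U /=.
by move: (\rank _) (\rank _) => a b; lia.
Qed.
End ShiftedJacobi.

(** * The Clifford structure *)

Lemma shifted_jacobi_family (R : realType) n (T : tensor31 R n) m l :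
  algebraic_curvature_tensor T ->
  (forall X, unit_vector X -> jacobi_mult T X l = m) ->
  jacobi_family (n - 1 - m)%N (shifted_jacobi T l).
Proof.
move=> hT hm; split.
- exact: shifted_jacobi_linear.
- exact: shifted_jacobi_sym.
- exact: shifted_jacobi_tr.
- exact: shifted_jacobi_swap.
move=> X X0; have uX := unit_vector_normalize X0.
rewrite -(hm _ uX) -(rank_shifted_jacobi l hT uX); set a := (Num.sqrt _)^-1.
have a0 : a != 0 by rewrite invr_eq0 sqrtr_eq0 -ltNge dotv_gt0.
rewrite (quadZ (shifted_jacobi_linear l hT) (shifted_jacobi_sym l hT)).
by rewrite (mxrank_scale_nz _ (expf_neq0 2 a0)).
Qed.

Section Normalization.
Variables (R : realType) (n r : nat) (T : tensor31 R n) (l : R).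
Hypothesis hT : algebraic_curvature_tensor T.
Hypothesis hO : osserman T.
Local Notation P := (quad (shifted_jacobi T l)).
Variables (D : 'M[R]_r) (B : 'rV[R]_n -> 'M[R]_(n, r)).
Hypothesis sD : D^T = D.
Hypothesis uD : D \in unitmx.
Hypothesis linB : linear B.
Hypothesis hB : forall Y, P Y = B Y *m D *m (B Y)^T.
Hypothesis freeB : forall Y, Y != 0 -> row_free (B Y)^T.

Definition gram X Y := (B X)^T *m B Y + (B Y)^T *m B X.

Lemma quad_gram Y : quad gram Y = (B Y)^T *m B Y.
Proof.
rewrite /quad /gram; move: (_ *m _) => M.
by apply/matrixP => i j; rewrite !mxE; field.
Qed.

(** The map [x |-> x *m (B Y)^T] carries the kernel of the pencil isomorphically onto the eigenspace
    of [B Y *m D *m (B Y)^T] for [c^-1]. Orthogonality to [Y] is automatic, since [P Y] is symmetric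
    and kills [Y]. *)
Lemma rank_gram_pencil c Y : c != 0 -> unit_vector Y ->
  \rank (invmx D - c *: quad gram Y) = (r - jacobi_mult T Y (l + c^-1))%N.
Proof.
move=> c0 uY; set M := invmx D - _.
have Y0 := unit_vector_neq0 uY; have fB := freeB Y0.
have kE (x : 'rV_r) : x *m M = 0 <-> x *m invmx D = c *: (x *m (B Y)^T *m B Y).
  rewrite /M mulmxBr -(scalemxAr c) quad_gram mulmxA.
  by split=> [/subr0_eq //|->]; rewrite subrr.
suff e : (kermx M *m (B Y)^T :=:
    eigenspace (jacobi T Y) (l + c^-1)%R :&: kermx Y^T)%MS.
  rewrite /jacobi_mult -e mxrankMfree // mxrank_ker.
  by rewrite subKn // rank_leq_row.
apply/eqmxP/andP; split; apply/rV_subP => w.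
  move=> /submxP[y ->]; rewrite mulmxA; set x := y *m _.
  have /kE xD : x *m M = 0 by rewrite /x -mulmxA mulmx_ker mulmx0.
  apply/(sub_eigenspace_jacobi l hT _ _ uY).
  have wP : x *m (B Y)^T *m P Y = c^-1 *: (x *m (B Y)^T).
    rewrite hB !mulmxA; have -> : x *m (B Y)^T *m B Y = c^-1 *: (x *m invmx D).
      by rewrite xD scalerA mulVf // scale1r.
    by rewrite -!scalemxAl mulmxKV.
  split; first by rewrite wP; congr (_ *: _); ring.
  have := congr1 (fun M : 'rV_n => dotv M Y) wP.
  rewrite dotv_trmx {1}/quad linearZ /= shifted_jacobi_tr //.
  rewrite -/(quad (shifted_jacobi T l) Y).
  rewrite shifted_jacobi_self // dotvZl /dotv trmx0 mulmx0 mxE => /esym/eqP.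
  by rewrite mulf_eq0 invr_eq0 (negPf c0) => /eqP.
move=> /(sub_eigenspace_jacobi l hT _ _ uY)[]; rewrite addrC addKr => wP wY.
have -> : w = (c *: (w *m B Y *m D)) *m (B Y)^T.
  by rewrite -scalemxAl -!mulmxA (mulmxA (B Y)) -hB wP scalerA mulfV // scale1r.
apply: submxMr; apply/sub_kermxP/kE.
rewrite -scalemxAl mulmxK // -scalemxAl -!scalemxAl.
have -> : w *m B Y *m D *m (B Y)^T = c^-1 *: w.
  by rewrite -!mulmxA (mulmxA (B Y)) -hB wP.
by rewrite -scalemxAl scalerA mulfV // scale1r.
Qed.

Lemma gram_isospectral_pencil : isospectral_pencil gram (invmx D).
Proof.
split.
- move=> a X X' Y; rewrite /gram linB linearD linearZ /= mulmxDl mulmxDr.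
  by rewrite -scalemxAl -scalemxAr scalerDr addrACA.
- by move=> X Y; rewrite /gram addrC.
- by move=> X Y; rewrite /gram linearD /= !trmx_mul !trmxK addrC.
- by rewrite trmx_inv sD.
- move=> Y x Y0 x0; rewrite quad_gram.
  have -> : x *m ((B Y)^T *m B Y) *m x^T = (x *m (B Y)^T) *m (x *m (B Y)^T)^T.
    by rewrite trmx_mul trmxK !mulmxA.
  by apply: dotv_gt0; rewrite mulmx_free_eq0 // freeB.
move=> c Y Y' uY uY'; case: (eqVneq c 0) => [->|c0]; first by rewrite !scale0r.
by rewrite !rank_gram_pencil // (hO uY uY').
Qed.

Lemma normalized_factorization : (r.+1 ^ 2 < 4 * n)%N ->
  exists (d : 'rV_r) (B' : 'rV_n -> 'M_(n, r)),
    [/\ forall i, d 0 i != 0, linear B',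
        forall Y, P Y = B' Y *m diag_mx d *m (B' Y)^T &
        forall Y, (B' Y)^T *m B' Y = (dotv Y Y)%:M].
Proof.
move=> rn; have uS : invmx D \in unitmx by rewrite unitmx_inv.
have [C [d [CS CG]]] := pencil_diag gram_isospectral_pencil uS rn.
have n0 : (0 < n)%N by lia.
pose Y0 : 'rV[R]_n := delta_mx 0 (Ordinal n0).
have uY0 : unit_vector Y0 := unit_vector_delta R _.
have uC : C \in unitmx.
  have := mulmx1_unit (A := C) (B := quad gram Y0 *m C^T).
  by rewrite mulmxA CG uY0 => /(_ erefl)[].
have d0 i : d 0 i != 0.
  have : diag_mx d \in unitmx by rewrite -CS !unitmx_mul uC uS unitmx_tr.
  by rewrite unitmxE det_diag unitfE => /prodf_neq0 ->.
pose d' : 'rV[R]_r := \row_i (d 0 i)^-1.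
have dd' : diag_mx d *m diag_mx d' = 1%:M.
  rewrite mulmx_diag -diag_const_mx; congr diag_mx; apply/matrixP => i j.
  by rewrite !mxE divff.
(* This inverts [C *m invmx D *m C^T = diag_mx d]; replacing [B Y] by [B Y *m C^T] then turns the
   core into [diag_mx d']. *)
have eD : D = C^T *m diag_mx d' *m C.
  have e1 : invmx D *m (C^T *m diag_mx d' *m C) = 1%:M.
    apply: (can_inj (mulKmx uC)); rewrite mulmx1 !mulmxA CS dd'.
    by rewrite mul1mx.
  by rewrite -[LHS]mulmx1 -e1 mulmxA mulmxV // mul1mx.
exists d', (fun Y => B Y *m C^T); split.
- by move=> i; rewrite mxE invr_eq0.
- by move=> a Y Y'; rewrite linB mulmxDl -scalemxAl.
- by move=> Y; rewrite hB eD trmx_mul trmxK !mulmxA.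
- by move=> Y; rewrite trmx_mul trmxK -mulmxA (mulmxA _ (B Y)) -quad_gram mulmxA CG.
Qed.
End Normalization.

Section CliffordStructure.
Variables (R : realType) (n r : nat) (T : tensor31 R n) (l : R).
Hypothesis hT : algebraic_curvature_tensor T.
Local Notation P := (quad (shifted_jacobi T l)).
Variables (d : 'rV[R]_r) (B : 'rV[R]_n -> 'M[R]_(n, r)).
Hypothesis d0 : forall i, d 0 i != 0.
Hypothesis linB : linear B.
Hypothesis hB : forall Y, P Y = B Y *m diag_mx d *m (B Y)^T.
Hypothesis gB : forall Y, (B Y)^T *m B Y = (dotv Y Y)%:M.

(** [J s] sends [Y] to column [s] of [B Y]. Skewness comes from [Y *m P Y = 0], the Hurwitz
    relations from polarizing [gB], and the curvature formula from the fact that the Jacobi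
    operators determine the tensor. *)
Lemma cliff_structure_of_factorization : cliff_structure r T.
Proof.
pose J s := lin1_mx (fun Y => (col s (B Y))^T).
have JE Y s : Y *m J s = (col s (B Y))^T.
  by apply: mul_rV_linear1 => a X X'; rewrite linB !linearD !linearZ.
have dJ Y s q : dotv (Y *m J s) (Y *m J q) = (s == q)%:R * dotv Y Y.
  have /matrixP/(_ s q) := gB Y; rewrite mxE [in RHS]mxE mulrC mulr_natr => <-.
  by rewrite /dotv !JE mxE; apply: eq_bigr => i _; rewrite !mxE.
have PJ Y Z : Z *m P Y = \sum_s (d 0 s * dotv (Y *m J s) Z) *: (Y *m J s).
  apply/matrixP => i j; rewrite hB !mulmxA summxE mxE; apply: eq_bigr => s _.
  rewrite !mul_mx_diag [RHS]mxE [X in X * _]mxE JE; congr (_ * _); last by rewrite !mxE.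
  rewrite mulrC; congr (_ * _); rewrite /dotv !mxE; apply: eq_bigr => k _.
  by rewrite !mxE ord1 mulrC.
(* The vectors [Y *m J q] are pairwise orthogonal, so pairing [Y *m P Y = 0] with [Y *m J s]
   isolates one coefficient. *)
have YJ Y s : dotv (Y *m J s) Y = 0.
  case: (eqVneq Y 0) => [->|Y0]; first by rewrite mul0mx /dotv mul0mx mxE.
  have := PJ Y Y; rewrite shifted_jacobi_self // => /esym/(congr1 (dotv (Y *m J s))).
  have -> : dotv (Y *m J s) 0 = 0 by rewrite /dotv trmx0 mulmx0 mxE.
  have -> : dotv (Y *m J s) (\sum_s0 (d 0 s0 * dotv (Y *m J s0) Y) *: (Y *m J s0))
      = d 0 s * dotv (Y *m J s) Y * dotv Y Y.
    rewrite dotv_sumr (bigD1 s) //= big1 ?addr0 => [|q qs].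
      by rewrite dotvZr dJ eqxx mul1r.
    by rewrite dotvZr dJ eq_sym (negPf qs) mul0r mulr0.
  move/eqP; rewrite !mulf_eq0 (negPf (d0 s)) (gt_eqF (dotv_gt0 Y0)) orbF.
  by move/eqP.
have skewJ s : (J s)^T = - J s.
  apply/eqP; rewrite -addr_eq0; apply/eqP; apply: symmx_form_eq.
  - by rewrite linearD /= trmxK addrC.
  - by rewrite trmx0.
  move=> u; rewrite mulmx0 mul0mx mulmxDr mulmxDl.
  apply/matrixP => i j; rewrite !ord1 mxE -!/(dotv _ _) dotv_trmx trmxK.
  by rewrite [dotv u _]dotvC YJ addr0 mxE.
have orthJ s q : J s *m (J q)^T + J q *m (J s)^T = (2 * (s == q)%:R)%:M.
  apply: symmx_form_eq.
  - by rewrite linearD /= !trmx_mul !trmxK addrC.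
  - by rewrite tr_scalar_mx.
  move=> u; apply/matrixP => i j; rewrite !ord1 -!/(dotv _ _).
  rewrite mulmxDr dotvDl !mulmxA (dotv_trmx (J q)^T) (dotv_trmx (J s)^T) !trmxK.
  by rewrite !dJ mul_mx_scalar dotvZl (eq_sym q); ring.
(* The choice of [mu s] makes [mu s - lambda0] equal to [d 0 s], the coefficient in [PJ]. *)
exists l, (fun s => l + d 0 s), J; split.
- by move=> s /eqP; rewrite -subr_eq0 addrC addKr (negPf (d0 s)).
- exact: skewJ.
- move=> s; have := orthJ s s; rewrite eqxx mulr1 -mulr2n -scaler_nat.
  by rewrite -[X in X%:M]mulr1 -scale_scalar_mx => /scalemx_inj -> //; rewrite pnatr_eq0.
- move=> s q; have := orthJ s q; rewrite !skewJ !mulmxN -opprD => /(congr1 -%R).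
  by rewrite opprK => ->; rewrite raddfN.
move=> X Y Z.
have skewJd U V s : dotv U (V *m J s) = - dotv (U *m J s) V.
  by rewrite dotv_trmx skewJ mulmxN [in RHS]dotvC dotvNl opprK dotvC.
have PbJ U V W : W *m shifted_jacobi T l U V =
    \sum_s (d 0 s *: (dotv (U *m J s) W *: (V *m J s)
                      + dotv (V *m J s) W *: (U *m J s))).
  have := quad_line (shifted_jacobi_linear l hT) (shifted_jacobi_sym l hT) U V 1.
  rewrite !scale1r expr1n scale1r => /(congr1 (mulmx W)).
  rewrite !mulmxDr !PJ => /esym e; apply: (addrI (W *m P U)); apply: (addIr (W *m P V)).
  rewrite !PJ e -!big_split /=; apply: eq_bigr => s _.
  rewrite mulmxDl dotvDl; apply/matrixP => i j; rewrite !mxE.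
  by move: (U *m J s) (V *m J s) => A A'; ring.
(* The curvature part of the difference is [2 T X Y Z - T Y Z X - T Z X Y], which the Bianchi
   identity turns into [3 T X Y Z]. *)
have T3 : 3 *: T X Y Z = (Y *m shifted_jacobi T l X Z - X *m shifted_jacobi T l Y Z)
    + (3 * l) *: (dotv X Z *: Y - dotv Y Z *: X).
  rewrite !shifted_jacobiE // (dotvC Y X).
  have -> : T Z X Y = - T X Y Z - T Y Z X.
    by apply/eqP; rewrite eq_sym -opprD eqr_oppLR -addr_eq0 (act_bianchi hT).
  rewrite [T Y X Z](act_skew12 hT) [T Z Y X](act_skew12 hT).
  move: (T X Y Z) (T Y Z X) => A A'; apply/matrixP => i j; rewrite !mxE; ring.
have three0 : (3 : R) != 0 by rewrite pnatr_eq0.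
apply: (scalerI three0); rewrite T3 !PbJ [RHS]scalerDr (scalerA 3 l) [LHS]addrC.
congr (_ + _).
rewrite scaler_sumr -sumrB; apply: eq_bigr => s _.
have -> : l + d 0 s - l = d 0 s by ring.
rewrite scalerA mulrA divff // mul1r -scalerBr; congr (_ *: _).
rewrite (dotvC (Y *m J s) X) skewJd.
move: (X *m J s) (Y *m J s) (Z *m J s) => A A' A''.
by apply/matrixP => i j; rewrite !mxE; ring.
Qed.
End CliffordStructure.

Theorem proposition1 (R : realType) (n : nat) (T : tensor31 R n) (m nu : nat)
  (hT : algebraic_curvature_tensor T)
  (hO : osserman T)
  (hm : max_jacobi_mult T m)
  (hnu : nu = (n - 1 - m)%N)
  (hn3 : (3 * nu <= n)%N)
  (hn4 : (nu%:R + 1) ^+ 2 / 4 < n%:R :> R) :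
  cliff_structure nu T.
Proof.
have [[X [l [uX hl]]] _] := hm.
have n0 : (0 < n)%N.
  rewrite lt0n; apply/negP => /eqP n0; have := unit_vector_neq0 uX.
  by case/eqP; apply/matrixP => i j; have := ltn_ord j; rewrite {2}n0.
have PbJ : jacobi_family nu (shifted_jacobi T l).
  (* The Osserman condition carries the multiplicity of [l] from the one unit vector [X] to all
     others. *)
  by rewrite hnu; apply: shifted_jacobi_family => // Y uY; rewrite -hl; exact: hO.
have [D [B [sD uD linB hB]]] := global_factorization PbJ n0 hn3.
have freeB Y : Y != 0 -> row_free (B Y)^T.
  move=> Y0; have [L LB] := jf_left_inv PbJ Y0 (hB Y).
  by apply/row_freeP; exists L^T; rewrite -trmx_mul LB trmx1.
have hn : (nu.+1 ^ 2 < 4 * n)%N.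
  by move: hn4; rewrite ltr_pdivrMr // natr1 -natrX -natrM ltr_nat mulnC.
have [d [B' [d0 linB' hB' gB']]] :=
  normalized_factorization hT hO sD uD linB hB freeB hn.
exact (cliff_structure_of_factorization hT d0 linB' hB' gB').
Qed.
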